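(* Let $\gamma$ be a non-collision orbit of the regularized planar two-center problem lying on a regular torus $\mathbb{T}$ with rotation number $W$. Then its bi-infinite syzygy sequence is: $\dots121212\dots$ if $\mathbb{T}$ is of type P; $\dots 1\,3^{n_1}\,2\,3^{n_2}\,1\,3^{n_3}\,2\dots$ if $\mathbb{T}$ is of type L; $\dots 1\,3^{n_1}\,1\,3^{n_2}\,1\,3^{n_3}\,1\dots$ or $\dots 2\,3^{n_1}\,2\,3^{n_2}\,2\,3^{n_3}\,2\dots$ if $\mathbb{T}$ is of type S; where in the L and S cases $(n_i)_{i\in\mathbb{Z}}$ is the Sturmian sequence for rotation number $W$ and some intercept $y_0$. Conversely, in the L and S cases, for every intercept $y_0$ for which the line $y=Wx+y_0$ avoids $\mathbb{Z}^2$, the sequence of the corresponding form with $(n_i)$ the Sturmian sequence for $W$ and $y_0$ is realized by a non-collision orbit on $\mathbb{T}$.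
   Context: Fix $d>0$ and masses $m_1,m_2>0$ at the points $(-d,0)$ and $(d,0)$ of the plane. A test particle moves with Hamiltonian $H=\tfrac12(p_x^2+p_y^2)-m_1/\sqrt{(x+d)^2+y^2}-m_2/\sqrt{(x-d)^2+y^2}$; only energies $h<0$ are considered. Regularization: introduce $(\lambda,\nu)\in\mathbb{R}\times(\mathbb{R}/2\pi\mathbb{Z})$ by $x+iy=d\sin(\nu+i\lambda)$, i.e. $(x,y)=(d\cosh\lambda\sin\nu,\ d\sinh\lambda\cos\nu)$ (a double cover of the plane branched over the two centers, which correspond to $(\lambda,\nu)=(0,\pm\pi/2)$), with conjugate momenta $p_\lambda,p_\nu$, and the time change $dt=d^2(\cosh^2\lambda-\sin^2\nu)\,d\tau$. On the energy level $H=h$ the motion becomes (in time $\tau$) the flow of $H_\lambda(\lambda,p_\lambda)+H_\nu(\nu,p_\nu)$ on its zero level, where $H_\lambda=\tfrac12p_\lambda^2-d(m_1+m_2)\cosh\lambda-hd^2\cosh^2\lambda$ and $H_\nu=\tfrac12p_\nu^2+d(m_1-m_2)\sin\nu+hd^2\sin^2\nu$; each orbit lies in a set $\{H_\lambda=-g,\ H_\nu=g\}$, $g$ being a separation constant (the value of Euler's second integral). Regular torus: a compact connected component $\mathbb{T}=C_\lambda\times C_\nu$ of such a set, where $-g$ is a regular value of $H_\lambda$ and $g$ a regular value of $H_\nu$; $C_\lambda$ is a closed curve in the $(\lambda,p_\lambda)$-plane, $C_\nu$ a closed curve in the cylinder $(\mathbb{R}/2\pi\mathbb{Z})\times\mathbb{R}$.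 Every regular torus is of one of three types: S if $C_\nu$ is contractible in the cylinder; L if $C_\nu$ winds around the cylinder and $C_\lambda$ meets $\{\lambda=0\}$; P if $C_\nu$ winds around the cylinder and $C_\lambda$ does not meet $\{\lambda=0\}$. Rotation number: with $T_\lambda,T_\nu$ the $\tau$-periods of the motions on $C_\lambda$, $C_\nu$, $W=T_\nu/T_\lambda>0$. With angles $\theta_1\in\mathbb{R}/\mathbb{Z}$ along $C_\nu$, $\theta_2\in\mathbb{R}/\mathbb{Z}$ along $C_\lambda$, each increasing uniformly in $\tau$ with period 1, orbits on $\mathbb{T}$ lift to lines $\theta_2=W\theta_1+\mathrm{const}$. Syzygies: the particle is on the $x$-axis iff $\lambda=0$ or $\nu\equiv\pm\pi/2$. Symbol 3: $\lambda=0$, $\nu\not\equiv\pm\pi/2$ (strictly between the centers); symbol 1: $\nu\equiv-\pi/2$, $\lambda\neq0$ ($x<-d$); symbol 2: $\nu\equiv\pi/2$, $\lambda\neq0$ ($x>d$). Collision points: $\lambda=0$, $\nu\equiv\pm\pi/2$. A non-collision orbit is an orbit of the regularized flow on a regular torus containing no collision point; its syzygy sequence is the bi-infinite sequence of symbols recorded in time order. Sturmian sequence: for $m>0$ and $y_0$ with the line $y=mx+y_0$ avoiding $\mathbb{Z}^2$, put $y_k=y_0+km$ and, for $k\in\mathbb{Z}$, $n_k=\lfloor m\rfloor$ if $\{y_{k-1}\}+\{m\}<1$, $n_k=\lfloor m\rfloor+1$ if $\{y_{k-1}\}+\{m\}>1$ ($\lfloor\cdot\rfloor$ floor, $\{\cdot\}$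 fractional part). *)

(* Defs.v *)
From HB Require Import structures.
From mathcomp Require Import all_boot all_order all_algebra.
From mathcomp Require Import all_classical all_reals all_analysis.
Set Implicit Arguments. Unset Strict Implicit. Unset Printing Implicit Defensive.
Import Order.TTheory GRing.Theory Num.Theory.
Import numFieldNormedType.Exports.
Local Open Scope classical_set_scope.
Local Open Scope ring_scope.

Section TwoCenter.
Variable R : realType.

Definition coshR (x : R) : R := (expR x + expR (- x)) / 2.
Definition sinhR (x : R) : R := (expR x - expR (- x)) / 2.

Definition Hlam (d m1 m2 h : R) (l p : R) : R :=
  p ^+ 2 / 2 - d * (m1 + m2) * coshR l - h * d ^+ 2 * coshR l ^+ 2.
(* H_nu(v, p) = p^2/2 + d(m1-m2) sin v + h d^2 sin^2 v   (v : lift of nu to R) *)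
Definition Hnu (d m1 m2 h : R) (v p : R) : R :=
  p ^+ 2 / 2 + d * (m1 - m2) * sin v + h * d ^+ 2 * sin v ^+ 2.

Definition dHlam (d m1 m2 h : R) (l : R) : R :=
  - d * (m1 + m2) * sinhR l - 2 * h * d ^+ 2 * coshR l * sinhR l.
Definition dHnu (d m1 m2 h : R) (v : R) : R :=
  d * (m1 - m2) * cos v + 2 * h * d ^+ 2 * sin v * cos v.

(* level sets (the nu-level set is taken in the universal cover R x R
   of the cylinder (R/2piZ) x R) *)
Definition lev_lam (d m1 m2 h : R) (c : R) : set (R * R) :=
  [set z | Hlam d m1 m2 h z.1 z.2 = c].
Definition lev_nu (d m1 m2 h : R) (c : R) : set (R * R) :=
  [set z | Hnu d m1 m2 h z.1 z.2 = c].

Definition regular_lam (d m1 m2 h : R) (c : R) : Prop :=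
  forall l p, Hlam d m1 m2 h l p = c -> (dHlam d m1 m2 h l != 0) \/ (p != 0).
Definition regular_nu (d m1 m2 h : R) (c : R) : Prop :=
  forall v p, Hnu d m1 m2 h v p = c -> (dHnu d m1 m2 h v != 0) \/ (p != 0).

Definition lam_sol (d m1 m2 h : R) (l pl : R -> R) : Prop :=
  forall t : R, is_derive t (1 : R) l (pl t) /\ is_derive t 1 pl (- dHlam d m1 m2 h (l t)).
Definition nu_sol (d m1 m2 h : R) (v pv : R -> R) : Prop :=
  forall t : R, is_derive t (1 : R) v (pv t) /\ is_derive t 1 pv (- dHnu d m1 m2 h (v t)).

(* an orbit of the regularized flow H_lambda + H_nu, nu lifted to R *)
Definition reg_orbit (d m1 m2 h : R) (l pl v pv : R -> R) : Prop :=
  lam_sol d m1 m2 h l pl /\ nu_sol d m1 m2 h v pv.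

Definition eqmod2pi (x a : R) : Prop := exists k : int, x = a + k%:~R * (2 * pi).

Definition lam_period (d m1 m2 h : R) (Cl : set (R * R)) (T : R) : Prop :=
  forall l pl, lam_sol d m1 m2 h l pl -> Cl (l 0, pl 0) ->
    0 < T /\ (forall t, l (t + T) = l t /\ pl (t + T) = pl t) /\
    (forall T', 0 < T' < T -> ~ (forall t, l (t + T') = l t /\ pl (t + T') = pl t)).

(* T is the tau-period of the motion on C_nu, the curve of the cylinder whose
   lift to R x R contains the connected component K *)
Definition nu_period (d m1 m2 h : R) (K : set (R * R)) (T : R) : Prop :=
  forall v pv, nu_sol d m1 m2 h v pv -> K (v 0, pv 0) ->
    0 < T /\ (forall t, eqmod2pi (v (t + T)) (v t) /\ pv (t + T) = pv t) /\
    (forall T', 0 < T' < T ->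
       ~ (forall t, eqmod2pi (v (t + T')) (v t) /\ pv (t + T') = pv t)).

(* the orbit lies on the torus C_lambda x C_nu, where C_nu is the projection
   of the lifted component K *)
Definition on_torus (Cl K : set (R * R)) (l pl v pv : R -> R) : Prop :=
  Cl (l 0, pl 0) /\ exists k : int, K (v 0 + k%:~R * (2 * pi), pv 0).

(* C_nu winds around the cylinder: its lift connects a point to its
   2pi-translate; C_nu is contractible iff it does not wind *)
Definition winds (K : set (R * R)) : Prop :=
  exists x p, K (x, p) /\ K (x + 2 * pi, p).
Definition meets_lam0 (Cl : set (R * R)) : Prop := exists p, Cl (0, p).

Definition typeS (Cl K : set (R * R)) : Prop := ~ winds K.
Definition typeL Cl K : Prop := winds K /\ meets_lam0 Cl.
Definition typeP Cl K : Prop := winds K /\ ~ meets_lam0 Cl.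

Definition noncollision (l v : R -> R) : Prop :=
  forall t, ~ (l t = 0 /\ (eqmod2pi (v t) (pi / 2) \/ eqmod2pi (v t) (- (pi / 2)))).

Definition syz (l v : R -> R) (t : R) (a : nat) : Prop :=
  (a = 3%N /\ l t = 0 /\ ~ eqmod2pi (v t) (pi / 2) /\ ~ eqmod2pi (v t) (- (pi / 2))) \/
  (a = 1%N /\ eqmod2pi (v t) (- (pi / 2)) /\ l t != 0) \/
  (a = 2%N /\ eqmod2pi (v t) (pi / 2) /\ l t != 0).

Definition syzygy_seq (l v : R -> R) (s : int -> nat) : Prop :=
  exists tt : int -> R,
    (forall k, tt k < tt (k + 1)) /\
    (forall t, (exists a, syz l v t a) <-> exists k, tt k = t) /\
    (forall k, syz l v (tt k) (s k)).

Definition fracR (x : R) : R := x - (Num.floor x)%:~R.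
Definition avoids_lattice (m y0 : R) : Prop :=
  forall x y : int, y%:~R != m * x%:~R + y0.
Definition sturm (m y0 : R) (k : int) : int :=
  if fracR (y0 + (k - 1)%:~R * m) + fracR m < 1 then Num.floor m
  else Num.floor m + 1.

(* s = ... sep_0 3^{n_1} sep_1 3^{n_2} sep_2 3^{n_3} ... *)
Definition block_form (s : int -> nat) (sep : int -> nat) (n : int -> int) : Prop :=
  exists j : int -> int,
    (forall i, j i < j (i + 1)) /\
    (forall i, s (j i) = sep i) /\
    (forall i k, j i < k < j (i + 1) -> s k = 3%N) /\
    (forall i, j (i + 1) - j i - 1 = n (i + 1)).

Definition sepL (i : int) : nat := if (2 %| i)%Z then 1%N else 2%N.

End TwoCenter.

(* Main.v *)
Require Import Defs.
From HB Require Import structures.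
From mathcomp Require Import all_boot all_order all_algebra.
From mathcomp Require Import all_classical all_reals all_analysis.
From mathcomp Require Import ring lra zify.
Import Order.TTheory GRing.Theory Num.Theory.
Import numFieldNormedType.Exports.
Local Open Scope classical_set_scope.
Local Open Scope ring_scope.

(** Both separated motions are one-dimensional Newton equations with a
    reflection symmetry: lambda -> - lambda, and nu -> 2 c - nu about each angle
    c = +-pi/2.  By uniqueness of solutions the zeros of lambda are therefore
    spaced by exactly Tl/2, and the passages of nu through +-pi/2 by exactly
    Tn/2.  In units of Tl/2, measured from a zero of lambda, the latter occur at
    y0 + i W, so the number of symbols 3 between two consecutive ones is
    floor(y0 + (i+1) W) - floor(y0 + i W), a Sturmian sequence.  Which of these
    events occur at all is decided by the potentials, which are quadratic
    polynomials in cosh lambda (convex) and in sin nu (concave).  For the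
    converse, a global orbit on the torus exists by Picard iteration, and a time
    shift of lambda alone realizes every intercept. *)

Set Implicit Arguments. Unset Strict Implicit. Unset Printing Implicit Defensive.

(** * Calculus on the real line *)

(** The reflections act differently on the two kinds of motion. An oscillating coordinate is
    compared with its reflected copy run in the same time direction; this gives an antiperiod, and
    minimality of the period makes it exactly half. A winding [v] is monotone, so its reflection has
    to be combined with time reversal; this shows that both halves of a turn last equally long, once
    minimality has fixed the advance per period to a single turn. The types are topological
    statements about connected components, whereas the analysis needs inequalities: [K] winds
    exactly when V_nu < g everywhere, and types L and S enter the lambda-motion only through
    V_lambda(0) <= -g. The lambda-force grows exponentially and is not globally Lipschitz, so
    uniqueness and existence reach it only through a truncated force. The period hypotheses
    constrain existing orbits only: even [0 < Tl] has to be read off a solution. *)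

Section Calculus.
Variable R : realType.
Implicit Types (f g F : R -> R) (t u s x y a b c : R).

Lemma derD f g t a b : is_derive t 1 f a -> is_derive t 1 g b ->
  is_derive t 1 (fun x => f x + g x) (a + b).
Proof. by move=> hf hg; exact: is_deriveD. Qed.

Lemma derB f g t a b : is_derive t 1 f a -> is_derive t 1 g b ->
  is_derive t 1 (fun x => f x - g x) (a - b).
Proof. by move=> hf hg; exact: is_deriveB. Qed.

Lemma derN f t a : is_derive t 1 f a -> is_derive t 1 (fun x => - f x) (- a).
Proof. by move=> hf; exact: is_deriveN. Qed.

Lemma derM f g t a b : is_derive t 1 f a -> is_derive t 1 g b ->
  is_derive t 1 (fun x => f x * g x) (a * g t + f t * b).
Proof.
move=> hf hg; apply: is_derive_eq.
by rewrite /GRing.scale /= addrC [g t * _]mulrC.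
Qed.

Lemma der_cst c t : is_derive t 1 (fun _ : R => c) (0 : R).
Proof. exact: is_derive_cst. Qed.

Lemma derZ c f t a : is_derive t 1 f a -> is_derive t 1 (fun x => c * f x) (c * a).
Proof. by move=> hf; have := derM (der_cst c t) hf; rewrite mul0r add0r. Qed.

Lemma der_comp f g t a b : is_derive t 1 g b -> is_derive (g t) 1 f a ->
  is_derive t 1 (fun x => f (g x)) (a * b).
Proof. by move=> hg hf; exact: is_derive1_comp. Qed.

Lemma der_shift f t s a : is_derive (t + s) 1 f a ->
  is_derive t 1 (fun x => f (x + s)) a.
Proof.
move=> h; rewrite -[a]mulr1; apply: (@der_comp f (fun x => x + s)) => //.
by have := derD (is_derive_id t 1) (der_cst s t); rewrite addr0.
Qed.

Lemma der_compN f t a : is_derive (- t) 1 f a -> is_derive t 1 (fun x => f (- x)) (- a).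
Proof.
move=> h; rewrite -[- a]mulrN1; apply: (@der_comp f (fun x => - x)) => //.
Qed.

Lemma der_continuous f (f' : R -> R) :
  (forall t, is_derive t 1 f (f' t)) -> continuous f.
Proof. by move=> h t; apply/differentiable_continuous/derivable1_diffP; case: (h t). Qed.

Lemma ivt_le f a b c : continuous f -> a <= b ->
  (f a <= c <= f b) \/ (f b <= c <= f a) -> exists2 t, a <= t <= b & f t = c.
Proof.
move=> cf ab h.
have [|t tab ft] := @IVT R f a b c ab (continuous_subspaceT cf).
  by rewrite ge_min le_max; case: h => /andP[-> ->]; rewrite ?orbT.
by exists t => //; move: tab; rewrite in_itv.
Qed.

Lemma ivt f x y c : continuous f -> f x <= c <= f y -> exists t, f t = c.
Proof.
move=> cf h; case: (leP x y) => xy.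
  by have [//||t _ ?] := @ivt_le f x y c cf; [left|exists t].
by have [||t _ ?] := @ivt_le f y x c cf; [exact: ltW|right|exists t].
Qed.

Lemma continuous_sign f : continuous f -> (forall t, f t != 0) ->
  (forall t, 0 < f t) \/ (forall t, f t < 0).
Proof.
move=> cf n0; case: (ltP 0 (f 0)) => h0; [left|right] => t; rewrite ltNge; apply/negP => h.
  have [|s /eqP] := @ivt f t 0 0 cf; first by rewrite h ltW.
  by rewrite (negbTE (n0 s)).
have [|s /eqP] := @ivt f 0 t 0 cf; first by rewrite h0 h.
by rewrite (negbTE (n0 s)).
Qed.

Lemma mvt f (f' : R -> R) a b : (forall t, is_derive t 1 f (f' t)) -> a < b ->
  exists2 c, a < c < b & f b - f a = f' c * (b - a).
Proof.
move=> h ab; have [|c cab e] := @MVT R f f' a b ab.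
- by apply: continuous_subspaceT; exact: (der_continuous h).
- by exists c => //; move: cab; rewrite in_itv.
Qed.

Lemma der_ge0_homo f (f' : R -> R) a b : (forall t, is_derive t 1 f (f' t)) ->
  (forall t, a < t < b -> 0 <= f' t) -> a <= b -> f a <= f b.
Proof.
move=> h h0; rewrite le_eqVlt => /orP[/eqP->//|ab].
have [c cab e] := mvt h ab; rewrite -subr_ge0 e mulr_ge0 ?h0// subr_ge0 ltW//.
Qed.

Lemma der_gt0_homo f (f' : R -> R) a b : (forall t, is_derive t 1 f (f' t)) ->
  (forall t, a < t < b -> 0 < f' t) -> a < b -> f a < f b.
Proof.
move=> h h0 ab.
by have [c cab e] := mvt h ab; rewrite -subr_gt0 e mulr_gt0 ?h0// subr_gt0.
Qed.

Lemma der0_cst f a b : (forall t, is_derive t 1 f 0) -> f a = f b.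
Proof. exact: is_derive_0_is_cst. Qed.

(** The difference [y - x] is convex with a critical point of value 0 at time 0, which is therefore
    its minimum; this covers both time directions. *)
Lemma second_order_comparison (x y px py ax ay : R -> R) :
  (forall t, is_derive t 1 x (px t)) -> (forall t, is_derive t 1 px (ax t)) ->
  (forall t, is_derive t 1 y (py t)) -> (forall t, is_derive t 1 py (ay t)) ->
  x 0 = y 0 -> px 0 = py 0 -> (forall t, ax t <= ay t) -> forall t, x t <= y t.
Proof.
move=> hx hpx hy hpy e0 e1 le t.
have hp u : is_derive u 1 (fun s => py s - px s) (ay u - ax u) by apply: derB.
have hz u : is_derive u 1 (fun s => y s - x s) (py u - px u) by apply: derB.
have mono a b : a <= b -> py a - px a <= py b - px b.
  by apply: (der_ge0_homo hp) => u _; rewrite subr_ge0.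
case: (leP 0 t) => t0.
  have := @der_ge0_homo _ _ 0 t hz _ t0; rewrite e0 subrr subr_ge0; apply => u /andP[u0 _].
  by have := mono 0 u (ltW u0); rewrite e1 subrr.
have hn u : is_derive u 1 (fun s => x s - y s) (px u - py u) by apply: derB.
have := @der_ge0_homo _ _ t 0 hn _ (ltW t0); rewrite e0 subrr subr_le0; apply => u /andP[_ u0].
by have := mono u 0 (ltW u0); rewrite e1 subrr; lra.
Qed.

Lemma continuous_has_primitive_on f a b : continuous f -> a < b ->
  exists F, forall t, a < t < b -> is_derive t 1 F (f t).
Proof.
move=> cf ab.
exists (fun x => (\int[lebesgue_measure]_(t in [set` `[a, x]]) (f t))%R) => t /andP[at_ tb].
have [|//||df e] := @continuous_FTC1_closed R f a t b tb.
- apply: continuous_compact_integrable; first exact: segment_compact.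
  exact: continuous_subspaceT.
- exact: cf.
- by apply: DeriveDef => //; rewrite -derive1E.
Qed.

Lemma der0_cst_on f a b x y : (forall t, a < t < b -> is_derive t 1 f 0) ->
  a < x < b -> a < y < b -> f x = f y.
Proof.
move=> h; wlog xy : x y / x <= y.
  by move=> H hx hy; case: (leP x y) => [/H|/ltW/H] ->.
move=> /andP[ax xb] /andP[ay yb].
have hd t : t \in `[x, y] -> is_derive t 1 f 0.
  by rewrite in_itv/= => /andP[xt ty]; apply: h; rewrite (lt_le_trans ax)//= (le_lt_trans ty).
have hd' t : t \in `]x, y[%R -> is_derive t 1 f ((fun=> 0) t).
  by rewrite in_itv/= => /andP[xt ty]; apply: hd; rewrite in_itv/= !ltW.
have [|c _] := @MVT_segment R f (fun=> 0) x y xy hd'.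
- apply: continuous_in_subspaceT => t; rewrite inE/= => /hd[df _].
  exact/differentiable_continuous/derivable1_diffP.
- by rewrite mul0r => /eqP; rewrite subr_eq0 => /eqP.
Qed.

(** An integral gives a primitive only on a bounded interval to the right of its base point.
    Primitives on the intervals (-n-1, n+1) with the same value at 0 agree on overlaps and are
    glued; near any [t] the glued function is one single [G m]. *)
Lemma continuous_has_primitive f c : continuous f ->
  exists F, F 0 = c /\ forall t, is_derive t 1 F (f t).
Proof.
move=> cf.
have hex (n : nat) : exists F : R -> R, F 0 = c /\
    forall t, - n.+1%:R < t < n.+1%:R -> is_derive t 1 F (f t).
  have [|F hF] := @continuous_has_primitive_on f (- n.+1%:R) n.+1%:R cf.
    by rewrite (@lt_trans _ _ 0)// ?oppr_lt0 ltr0Sn.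
  exists (fun x => F x + (c - F 0)); split; first by rewrite addrC subrK.
  by move=> t /hF h; rewrite -[f t]addr0; apply: derD => //; exact: der_cst.
have [G hG] := boolp.choice hex.
have hb x (n : nat) : `|x| < n%:R -> - n.+1%:R < x < n.+1%:R.
  rewrite ltr_norml => /andP[h1 h2]; have : n%:R < n.+1%:R :> R by rewrite ltr_nat.
  by move=> h3; apply/andP; split; lra.
have agree (n m : nat) x : `|x| < n%:R -> `|x| < m%:R -> G n x = G m x.
  wlog nm : n m / (n <= m)%N.
    by move=> H h1 h2; case: (leqP n m) => [|/ltnW] /H ->.
  move=> hn _.
  have hd t : - n.+1%:R < t < n.+1%:R -> is_derive t 1 (fun x => G n x - G m x) 0.
    move=> ht; rewrite -(subrr (f t)); apply: derB; first exact: (hG n).2.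
    apply: (hG m).2; have : n.+1%:R <= m.+1%:R :> R by rewrite ler_nat.
    by case/andP: ht => *; apply/andP; split; lra.
  have := @der0_cst_on _ _ _ x 0 hd (hb _ _ hn).
  rewrite (hG n).1 (hG m).1 subrr => /(_ _)/eqP; rewrite subr_eq0 => e.
  by apply/eqP/e; rewrite oppr_lt0 ltr0Sn.
pose N x := (Num.truncn `|x|).+1.
have hN x : `|x| < (N x)%:R by rewrite /N truncnS_gt.
exists (fun x => G (N x) x); split; first exact: (hG _).1.
move=> t; pose m := (N t).+1.
have hm x : `|x - t| < 1 -> `|x| < m%:R.
  move=> hx; rewrite /m -natr1; have := hN t.
  have := ler_normD (x - t) t; rewrite subrK; lra.
apply: (@near_eq_is_derive _ _ _ (G m)).
  near=> x; apply: agree => //; apply: hm.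
  rewrite distrC; near: x; apply: (@nbhsx_ballx _ _ t); exact: ltr01.
apply: (hG m).2; apply: hb; apply: hm; rewrite subrr normr0; exact: ltr01.
Unshelve. all: by end_near. Qed.

End Calculus.

(** * Second-order equations x'' = F(x) *)

Section SecondOrderODE.
Variable R : realType.
Implicit Types (F x y p q z : R -> R) (t u s a b c : R).

Definition ode_sol F x p : Prop :=
  forall t, is_derive t 1 x (p t) /\ is_derive t 1 p (F (x t)).

Definition lip (L : R) F : Prop := forall a b, `|F a - F b| <= L * `|a - b|.

Lemma lip_ge0 L F : lip L F -> 0 <= L.
Proof.
by move=> h; have := le_trans (normr_ge0 _) (h 1 0); rewrite subr0 normr1 mulr1.
Qed.

Lemma lip_continuous L F : lip L F -> continuous F.
Proof.
move=> h t; have L0 := lip_ge0 h.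
apply/cvgrPdist_lt => e e0; near=> s.
apply: (le_lt_trans (h _ _)); apply: (@le_lt_trans _ _ ((L + 1) * `|t - s|)).
  by rewrite ler_wpM2r// lerDl.
rewrite -ltr_pdivlMl; last by lra.
near: s; apply: (@nbhsx_ballx _ _ t); rewrite mulr_gt0// invr_gt0; lra.
Unshelve. all: by end_near. Qed.

Lemma ode_sol_continuous F x p : ode_sol F x p -> continuous x /\ continuous p.
Proof.
move=> h; split; first by apply: (@der_continuous _ _ p) => t; exact: (h t).1.
by apply: (@der_continuous _ _ (F \o x)) => t; exact: (h t).2.
Qed.

Lemma ode_sol_shift F x p s : ode_sol F x p ->
  ode_sol F (fun t => x (t + s)) (fun t => p (t + s)).
Proof. by move=> h t; split; apply: der_shift; have [] := h (t + s). Qed.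

Lemma ode_sol_reverse F x p : ode_sol F x p ->
  ode_sol F (fun t => x (- t)) (fun t => - p (- t)).
Proof.
move=> h t; have [h1 h2] := h (- t); split; first exact: (der_compN h1).
by rewrite -[F _]opprK; apply: derN; exact: (der_compN h2).
Qed.

Lemma ode_sol_opp F x p : (forall a, F (- a) = - F a) -> ode_sol F x p ->
  ode_sol F (fun t => - x t) (fun t => - p t).
Proof. by move=> oF h t; rewrite oF; have [h1 h2] := h t; split; exact: derN. Qed.

(* (x-y)^2 + (p-q)^2 grows at most exponentially in both time directions. *)
Lemma ode_unique F L x p y q t0 : lip L F -> ode_sol F x p -> ode_sol F y q ->
  x t0 = y t0 -> p t0 = q t0 -> forall t, x t = y t /\ p t = q t.
Proof.
move=> hL hx hy e1 e2.
pose w t := (x t - y t) * (x t - y t) + (p t - q t) * (p t - q t).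
pose w' t := ((p t - q t) * (x t - y t) + (x t - y t) * (p t - q t)) +
  ((F (x t) - F (y t)) * (p t - q t) + (p t - q t) * (F (x t) - F (y t))).
have hw t : is_derive t 1 w (w' t).
  have [hx1 hx2] := hx t; have [hy1 hy2] := hy t.
  by apply: derD; apply: derM; apply: derB.
have L0 := lip_ge0 hL.
have bw t : `|w' t| <= (1 + L) * w t.
  have h1 : `|(x t - y t) * (p t - q t)| *+ 2 <= w t.
    rewrite /w -!expr2 -[X in _ <= X + _]real_normK ?num_real//.
    rewrite -[X in _ <= _ + X]real_normK ?num_real// normrM.
    have := sqr_ge0 (`|x t - y t| - `|p t - q t|); rewrite mulr2n; nra.
  have -> : w' t = ((x t - y t) * (p t - q t)) *+ 2
      + ((F (x t) - F (y t)) * (p t - q t)) *+ 2 by rewrite /w' !mulr2n; ring.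
  apply: (le_trans (ler_normD _ _)); rewrite !normrMn [X in _ <= X]mulrDl mul1r lerD//.
  apply: le_trans (ler_wpM2l L0 h1); rewrite mulrnAr lerMn2r/= !normrM mulrA.
  by rewrite ler_wpM2r//; exact: hL.
have w0 : w t0 = 0 by rewrite /w e1 e2 !subrr mulr0 addr0.
have wz t : w t <= 0.
  have hexp k u : is_derive u 1 (fun s => expR (k * s)) (expR (k * u) * k).
    have hk := derZ k (is_derive_id u 1); rewrite mulr1 in hk.
    exact: (der_comp hk (is_derive_expR _)).
  case: (leP t0 t) => tt.
    pose E s := - (expR (- (1 + L) * s) * w s).
    have hE u : is_derive u 1 E (- (expR (- (1 + L) * u) * (- (1 + L)) * w u
        + expR (- (1 + L) * u) * w' u)) by apply: derN; apply: derM.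
    have := der_ge0_homo hE _ tt; rewrite /E w0 mulr0 oppr0 oppr_ge0.
    rewrite pmulr_rle0 ?expR_gt0//; apply => u _.
    have := bw u; rewrite ler_norml => /andP[_ h].
    have := expR_gt0 (- (1 + L) * u); move: (expR _) => e e0; nra.
  pose E s := expR ((1 + L) * s) * w s.
  have hE u : is_derive u 1 E (expR ((1 + L) * u) * (1 + L) * w u
      + expR ((1 + L) * u) * w' u) by apply: derM.
  have := der_ge0_homo hE _ (ltW tt); rewrite /E w0 mulr0.
  rewrite pmulr_rle0 ?expR_gt0//; apply => u _.
  have := bw u; rewrite ler_norml => /andP[h _].
  have := expR_gt0 ((1 + L) * u); move: (expR _) => e e0; nra.
move=> t; have := wz t; rewrite /w -!expr2 => h.
have h1 := sqr_ge0 (x t - y t); have h2 := sqr_ge0 (p t - q t).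
split; apply/eqP; rewrite -subr_eq0 -sqrf_eq0 eq_le; apply/andP; split => //; lra.
Qed.

(** * Hyperbolic weights and global existence *)

Lemma is_derive_coshR t : is_derive t 1 (@coshR R) (sinhR t).
Proof.
have h : is_derive t 1 (fun s => expR (- s)) (- expR (- t)).
  by apply: der_compN; exact: is_derive_expR.
have := derZ 2^-1 (derD (is_derive_expR t) h).
rewrite /coshR /sinhR (_ : (fun s => _) = (fun s => (expR s + expR (- s)) / 2)).
  by rewrite mulrC.
by apply/funext => s; rewrite mulrC.
Qed.

Lemma is_derive_sinhR t : is_derive t 1 (@sinhR R) (coshR t).
Proof.
have h : is_derive t 1 (fun s => expR (- s)) (- expR (- t)).
  by apply: der_compN; exact: is_derive_expR.
have := derZ 2^-1 (derB (is_derive_expR t) h).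
rewrite /coshR /sinhR (_ : (fun s => _) = (fun s => (expR s - expR (- s)) / 2)).
  by rewrite opprK mulrC.
by apply/funext => s; rewrite mulrC.
Qed.

Lemma coshR_ge1 t : 1 <= coshR t.
Proof.
rewrite /coshR; have := expR_gt0 t; have e : expR t * expR (- t) = 1.
  by rewrite -expRD subrr expR0.
move: (expR t) (expR (- t)) e => a b e a0; have := sqr_ge0 (a - 1); nra.
Qed.

Lemma coshR0 : coshR (0 : R) = 1.
Proof. by rewrite /coshR oppr0 expR0; lra. Qed.

Lemma sinhR0 : sinhR (0 : R) = 0.
Proof. by rewrite /sinhR oppr0 subrr mul0r. Qed.

Lemma coshR_ge_half t : (1 + `|t|) / 2 <= coshR t.
Proof.
rewrite /coshR; have := expR_ge1Dx `|t|; have := expR_ge0 (- t); have := expR_ge0 t.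
by case: (ger0P t) => _; lra.
Qed.

Lemma sinhR_gt0 t : 0 < t -> 0 < sinhR t.
Proof. by move=> t0; rewrite /sinhR divr_gt0// subr_gt0 ltr_expR; lra. Qed.

Lemma coshRN t : coshR (- t) = coshR t.
Proof. by rewrite /coshR opprK addrC. Qed.

Lemma sinhRN t : sinhR (- t) = - sinhR t.
Proof. by rewrite /sinhR opprK -mulNr opprB. Qed.

(** The function [Y] below has second derivative exactly [D * coshR (K * t)] and zero initial data,
    so it dominates both [z] and [- z]. Integrating twice thus gains the factor [1 / K ^+ 2]
    uniformly on the whole line. *)
Lemma cosh_weight_bound (K D : R) z (z' z'' : R -> R) : 0 < K -> 0 <= D ->
  (forall t, is_derive t 1 z (z' t)) -> (forall t, is_derive t 1 z' (z'' t)) ->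
  z 0 = 0 -> z' 0 = 0 -> (forall t, `|z'' t| <= D * coshR (K * t)) ->
  forall t, `|z t| <= D / K ^+ 2 * coshR (K * t).
Proof.
move=> K0 D0 h1 h2 e0 e1 hb.
have hK u : is_derive u 1 (fun s => K * s) K.
  by have := derZ K (is_derive_id u 1); rewrite mulr1.
pose Y t := D / K ^+ 2 * (coshR (K * t) - 1).
have hY t : is_derive t 1 Y (D / K ^+ 2 * (sinhR (K * t) * K - 0)).
  exact: (derZ _ (derB (der_comp (hK t) (is_derive_coshR _)) (der_cst 1 t))).
have hY' t : is_derive t 1 (fun t => D / K ^+ 2 * (sinhR (K * t) * K - 0))
    (D * coshR (K * t)).
  have -> : D * coshR (K * t) = D / K ^+ 2 * ((coshR (K * t) * K * K + sinhR (K * t) * 0) - 0).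
    by field; rewrite gt_eqF.
  have h := der_comp (hK t) (is_derive_sinhR _).
  exact: (derZ _ (derB (derM h (der_cst K t)) (der_cst 0 t))).
have Y0 : Y 0 = 0 by rewrite /Y mulr0 coshR0 subrr mulr0.
have Y0' : D / K ^+ 2 * (sinhR (K * 0) * K - 0) = 0.
  by rewrite mulr0 sinhR0 mul0r subrr mulr0.
have YY t : Y t <= D / K ^+ 2 * coshR (K * t).
  by rewrite /Y ler_wpM2l ?divr_ge0 ?exprn_ge0 ?(ltW K0)// gerBl.
move=> t; apply: le_trans (YY t); rewrite ler_norml lerNl; apply/andP; split.
  have n1 u := derN (h1 u); have n2 u := derN (h2 u).
  apply: (second_order_comparison n1 n2 hY hY'); rewrite ?e0 ?e1 ?Y0 ?Y0' ?oppr0// => u.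
  by have := hb u; rewrite ler_norml => /andP[? _]; rewrite lerNl.
apply: (second_order_comparison h1 h2 hY hY'); rewrite ?e0 ?e1 ?Y0 ?Y0'// => u.
by have := hb u; rewrite ler_norml => /andP[].
Qed.

(** The intervals of radius [2 * c / 2 ^+ n] about [u n] are nested, this radius being the tail of
    the geometric series; the supremum of their left ends lies in all of them. *)
Lemma geometric_cauchy (u : nat -> R) c : (forall n, `|u n.+1 - u n| <= c / 2 ^+ n) ->
  exists l, forall n, `|l - u n| <= 2 * c / 2 ^+ n.
Proof.
move=> h.
have p2 n : 0 < 2 ^+ n :> R by rewrite exprn_gt0.
have half n : 2 * c / 2 ^+ n.+1 = c / 2 ^+ n by rewrite exprS; field; rewrite gt_eqF.
have c0 : 0 <= c by have := le_trans (normr_ge0 _) (h 0); rewrite expr0 divr1.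
pose A n := u n - 2 * c / 2 ^+ n; pose B n := u n + 2 * c / 2 ^+ n.
have step n : A n <= A n.+1 /\ B n.+1 <= B n.
  rewrite /A /B half; have := h n; rewrite ler_norml => /andP[h1 h2].
  have -> : 2 * c / 2 ^+ n = c / 2 ^+ n + c / 2 ^+ n by field; rewrite gt_eqF.
  by split; lra.
have incr n k : A n <= A (n + k)%N /\ B (n + k)%N <= B n.
  elim: k => [|k [IH1 IH2]]; first by rewrite addn0.
  by have [? ?] := step (n + k)%N; rewrite addnS; split; lra.
have AB n m : A n <= B m.
  have [h1 _] := incr n m; have [_ h2] := incr m n.
  apply: (le_trans h1); apply: le_trans h2; rewrite addnC /A /B.
  have : 0 <= 2 * c / 2 ^+ (m + n) by rewrite divr_ge0 ?mulr_ge0 ?(ltW (p2 _)).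
  lra.
pose S := range A.
have hS : has_sup S.
  by split; [exists (A 0), 0|exists (B 0) => _ [n _ <-]].
exists (sup S) => n; rewrite ler_norml.
have h1 : A n <= sup S by apply: sup_upper_bound => //; exists n.
have h2 : sup S <= B n by apply: sup_le_ub => [|_ [m _ <-]//]; exists (A 0), 0.
by move: h1 h2; rewrite /A /B => h1 h2; apply/andP; split; lra.
Qed.

Lemma small_geometric c e : 0 < e -> exists n, c / 2 ^+ n < e.
Proof.
move=> e0; exists (Num.truncn (c / e)).+1.
rewrite ltr_pdivrMr ?exprn_gt0// -ltr_pdivrMl// mulrC.
apply: lt_trans (truncnS_gt _) _.
by rewrite -natrX ltr_nat ltn_expl.
Qed.

(* Picard iteration is a contraction for the weight cosh(K t), K^2 = 2 L,
   which gives a global solution at once. *)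
Theorem ode_exists F (L B x0 p0 : R) : lip L F -> (forall a, `|F a| <= B) ->
  exists x p, ode_sol F x p /\ x 0 = x0 /\ p 0 = p0.
Proof.
move=> hL0 hB.
have {hL0}[{}L hL L0] : exists2 L, lip L F & 0 < L.
  exists (L + 1); last by have := lip_ge0 hL0; lra.
  by move=> a b; apply: (le_trans (hL0 a b)); rewrite ler_wpM2r// lerDl.
have B0 : 0 <= B by exact: le_trans (normr_ge0 _) (hB 0).
pose K := Num.sqrt (2 * L).
have K0 : 0 < K by rewrite sqrtr_gt0 mulr_gt0.
have K2 : K ^+ 2 = 2 * L by rewrite sqr_sqrtr// mulr_ge0// ltW.
have ch0 t : 0 < coshR (K * t) by exact: lt_le_trans ltr01 (coshR_ge1 _).
have cF := lip_continuous hL.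
(* The Picard map is made total so that choice yields an operator on all functions; on a
   discontinuous [x] the value [x] is a mere default. *)
have ex (x : R -> R) : exists y : R -> R, continuous x -> exists q : R -> R,
    (forall t, is_derive t 1 y (q t)) /\ (forall t, is_derive t 1 q (F (x t))) /\
    y 0 = x0 /\ q 0 = p0.
  have [cx|ncx] := pselect (continuous x); last by exists x.
  have cFx : continuous (F \o x) by move=> t; apply: continuous_comp; [exact: cx|exact: cF].
  have [q [q0 hq]] := continuous_has_primitive p0 cFx.
  have [y [y0 hy]] := continuous_has_primitive x0 (der_continuous hq).
  by exists y => _; exists q.
have [P hP] := boolp.choice ex.
have cP x : continuous x -> continuous (P x).
  by move=> /hP[q [h _]]; exact: der_continuous h.
have contr x y C : continuous x -> continuous y -> 0 <= C ->
    (forall t, `|x t - y t| <= C * coshR (K * t)) ->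
    forall t, `|P x t - P y t| <= C / 2 * coshR (K * t).
  move=> /hP[q [h1 [h2 [h3 h4]]]] /hP[r [k1 [k2 [k3 k4]]]] C0 hxy t.
  have -> : C / 2 = (L * C) / K ^+ 2 by rewrite K2; field; rewrite gt_eqF.
  apply: (cosh_weight_bound K0 _ (fun u => derB (h1 u) (k1 u))
    (fun u => derB (h2 u) (k2 u))) => //.
  - by rewrite mulr_ge0// ltW.
  - by rewrite h3 k3 subrr.
  - by rewrite h4 k4 subrr.
  - move=> u; apply: (le_trans (hL _ _)); rewrite -mulrA ler_wpM2l//; exact: ltW.
pose X0 t := x0 + p0 * t.
have hX0 t : is_derive t 1 X0 p0.
  by have := derD (der_cst x0 t) (derZ p0 (is_derive_id t 1)); rewrite add0r mulr1.
pose X n := iter n P X0.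
have cX n : continuous (X n).
  elim: n => [|n IH]; first exact: der_continuous hX0.
  exact: cP.
pose C := B / K ^+ 2.
have C0 : 0 <= C by rewrite divr_ge0// exprn_ge0// ltW.
have step n t : `|X n.+1 t - X n t| <= C / 2 ^+ n * coshR (K * t).
  elim: n t => [|n IH] t.
    rewrite expr0 divr1 /=; have [q [h1 [h2 [h3 h4]]]] := hP _ (cX 0).
    apply: (cosh_weight_bound K0 B0 (fun u => derB (h1 u) (hX0 u))
      (fun u => derB (h2 u) (der_cst p0 u))) => //.
    - by rewrite h3 /X0 mulr0 addr0 subrr.
    - by rewrite h4 subrr.
    - move=> u; rewrite subr0; apply: (le_trans (hB _)); rewrite -[X in X <= _]mulr1.
      by rewrite ler_wpM2l//; exact: coshR_ge1.
  have -> : C / 2 ^+ n.+1 = C / 2 ^+ n / 2.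
    by rewrite exprS; field; rewrite gt_eqF// exprn_gt0.
  by apply: (contr (X n.+1) (X n)); [exact: cX|exact: cX|rewrite divr_ge0// exprn_ge0|].
have lim t : exists l, forall n, `|l - X n t| <= 2 * (C * coshR (K * t)) / 2 ^+ n.
  by apply: geometric_cauchy => n; rewrite mulrAC; exact: step.
have [x hx] := boolp.choice lim.
have hx' n t : `|x t - X n t| <= 2 * C / 2 ^+ n * coshR (K * t).
  by apply: le_trans (hx t n) _; rewrite le_eqVlt; apply/orP; left; apply/eqP; ring.
have cch : continuous (fun t => coshR (K * t)).
  have hK u := derZ K (is_derive_id u 1).
  exact: (der_continuous (fun t => der_comp (hK t) (is_derive_coshR _))).
have CC n : 0 <= 2 * C / 2 ^+ n.
  by apply: divr_ge0; [exact: mulr_ge0|exact: exprn_ge0].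
have cx : continuous x.
  move=> t; apply/cvgrPdist_lt => e e0.
  (* Near [t] the weight stays below [coshR (K * t) + 1], so convergence is uniform there and a
     limit of continuous functions is continuous. *)
  have [n hn] : exists n, 2 * C * (coshR (K * t) + 1) / 2 ^+ n < e / 3.
    by apply: small_geometric; lra.
  have hn' s : coshR (K * s) < coshR (K * t) + 1 -> `|x s - X n s| < e / 3.
    move=> hs; apply: le_lt_trans (hx' n s) _; apply: le_lt_trans hn.
    by rewrite [X in _ <= X]mulrAC; apply: ler_wpM2l; [exact: CC|exact: ltW].
  have ht := hn' t; rewrite ltrDl ltr01 in ht; move/(_ isT) : ht => ht.
  near=> s.
  have hs : `|x s - X n s| < e / 3.
    apply: hn'; near: s; apply: (@cvgr_lt _ _ _ _ (fun s => coshR (K * s)) _ (cch t)).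
    by rewrite ltrDl.
  have hst : `|X n t - X n s| < e / 3.
    near: s; have /cvgrPdist_lt := cX n t; apply; lra.
  have -> : x t - x s = (x t - X n t) + (X n t - X n s) - (x s - X n s) by ring.
  apply: le_lt_trans (ler_normB _ _) _; apply: le_lt_trans (lerD (ler_normD _ _) (lexx _)) _.
  lra.
have Px : P x = x.
  apply/funext => t; apply/eqP; rewrite -subr_eq0 -normr_eq0 eq_le normr_ge0 andbT.
  rewrite leNgt; apply/negP => h.
  have [n hn] := small_geometric (2 * C * coshR (K * t)) h.
  have h1 : `|P x t - X n.+1 t| <= 2 * C / 2 ^+ n / 2 * coshR (K * t).
    by apply: (contr x (X n)); [|exact: cX|exact: CC|].
  have h2 := hx' n.+1 t.
  have e1 : P x t - x t = (P x t - X n.+1 t) - (x t - X n.+1 t) by ring.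
  have h3 : `|P x t - x t| <= `|P x t - X n.+1 t| + `|x t - X n.+1 t|.
    by rewrite e1; exact: ler_normB.
  have e2 : 2 * C * coshR (K * t) / 2 ^+ n =
     2 * C / 2 ^+ n / 2 * coshR (K * t) + 2 * C / 2 ^+ n.+1 * coshR (K * t).
    by rewrite exprS; field; rewrite gt_eqF// exprn_gt0.
  by move: hn; rewrite e2; lra.
have [q [h1 [h2 [h3 h4]]]] := hP _ cx.
exists x, q; rewrite Px in h1 h3; split; last by [].
by move=> t; split.
Unshelve. all: by end_near. Qed.

Lemma potential_energy (V V' x p : R -> R) : (forall t, is_derive t 1 V (V' t)) ->
  ode_sol (fun a => - V' a) x p ->
  forall t s, p t ^+ 2 / 2 + V (x t) = p s ^+ 2 / 2 + V (x s).
Proof.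
move=> hV sol t s.
apply: (@der0_cst _ (fun t => p t ^+ 2 / 2 + V (x t))) => u.
have [h1 h2] := sol u.
have := derD (derM (derM h2 h2) (der_cst 2^-1 u)) (der_comp h1 (hV (x u))).
by congr is_derive; field.
Qed.

End SecondOrderODE.

(** * Zeros of periodic orbits *)

Section PeriodicOrbits.
Variable R : realType.
Implicit Types (F x y p q : R -> R) (t u s a b c T : R).

Lemma invariant_intmul (P : R -> Prop) c : (forall t, P (t + c) <-> P t) ->
  forall (j : int) t, P (t + j%:~R * c) <-> P t.
Proof.
move=> h; have hn (n : nat) t : P (t + n%:R * c) <-> P t.
  elim: n => [|n IH]; first by rewrite mul0r addr0.
  by rewrite -natr1 mulrDl mul1r addrA h.
move=> [n|n] t; first exact: hn.
rewrite NegzE mulrNz -(hn n.+1 (t + _)) mulNr subrK//.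
Qed.

Lemma floor_reduction t t0 c : 0 < c ->
  exists (j : int) r, t = r + j%:~R * c /\ t0 <= r < t0 + c.
Proof.
move=> c0; pose j := Num.floor ((t - t0) / c).
exists j, (t - j%:~R * c); split; first by rewrite subrK.
have := floor_itv ((t - t0) / c); rewrite -/j intrD => /andP[h1 h2].
rewrite ler_pdivlMr// in h1; rewrite ltr_pdivrMr// in h2.
by apply/andP; split; lra.
Qed.

Lemma is_derive_unique x t a b : is_derive t 1 x a -> is_derive t 1 x b -> a = b.
Proof. by move=> [_ <-] [_ <-]. Qed.

Lemma der_at_max x p t a b : (forall s, is_derive s 1 x (p s)) -> a < t < b ->
  (forall s, a < s < b -> x s <= x t) -> p t = 0.
Proof.
move=> h tab hM; apply: (is_derive_unique (h t)).
apply: (@derive1_at_max _ x a b).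
- by case/andP: tab => *; lra.
- by move=> s _; case: (h s).
- by rewrite in_itv.
- by move=> s; rewrite in_itv/=; exact: hM.
Qed.

Lemma der_at_min x p t a b : (forall s, is_derive s 1 x (p s)) -> a < t < b ->
  (forall s, a < s < b -> x t <= x s) -> p t = 0.
Proof.
move=> h tab hm; apply/eqP; rewrite -oppr_eq0; apply/eqP.
apply: (der_at_max (fun s => derN (h s)) tab) => s sab.
by rewrite lerN2; exact: hm.
Qed.

Lemma periodic_extrema x p T : 0 < T -> (forall t, is_derive t 1 x (p t)) ->
  (forall t, x (t + T) = x t) ->
  exists tm tM, (forall t, x tm <= x t <= x tM) /\ p tm = 0 /\ p tM = 0.
Proof.
move=> T0 h per.
have cx := continuous_subspaceT (der_continuous h) : {within `[0, T], continuous x}.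
have [tM _ hM] := EVT_max (ltW T0) cx; have [tm _ hm] := EVT_min (ltW T0) cx.
have red t : exists2 r, r \in `[0, T] & x t = x r.
  have [j [r [-> hr]]] := floor_reduction t 0 T0; exists r.
    by rewrite in_itv/=; case/andP: hr => *; apply/andP; split; lra.
  by apply/(@invariant_intmul (fun t => x t = x r) T); [move=> s; rewrite per|].
have bd t : x tm <= x t <= x tM.
  by have [r hr ->] := red t; rewrite hM ?hm.
exists tm, tM; split=> //; split.
  apply: (@der_at_min x p tm (tm - 1) (tm + 1)) => // [|s _]; last by case/andP: (bd s).
  by apply/andP; split; lra.
apply: (@der_at_max x p tM (tM - 1) (tM + 1)) => // [|s _]; last by case/andP: (bd s).
by apply/andP; split; lra.
Qed.

(** Without another zero [x] would have one sign on (t0, t0 + T), and by periodicity the same sign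
    just before [t0]; then [t0] is an extremum and [p t0] vanishes. *)
Lemma transversal_zero_recurs x p T t0 : 0 < T -> (forall t, is_derive t 1 x (p t)) ->
  (forall t, x (t + T) = x t) -> x t0 = 0 -> p t0 != 0 ->
  exists2 t1, t0 < t1 < t0 + T & x t1 = 0.
Proof.
move=> T0 h per x0 p0; apply: contrapT => no.
have nz t : t0 < t < t0 + T -> x t != 0 by move=> ht; apply/eqP => e; apply: no; exists t.
have cx := der_continuous h.
have hm : t0 < t0 + T / 2 < t0 + T by apply/andP; split; lra.
have same t : t0 < t < t0 + T -> 0 < x t * x (t0 + T / 2).
  move=> ht; rewrite ltNge; apply/negP => hle.
  have key a b : t0 < a < t0 + T -> t0 < b < t0 + T -> a <= b -> x a * x b <= 0 -> False.
    move=> ha hb ab hx; have [|s hs es] := @ivt_le _ x a b 0 cx ab.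
      by case: (leP (x a) 0) => h1; case: (leP 0 (x b)) => h2; [left|right|right|right];
        apply/andP; split; nra.
    have /nz/eqP : t0 < s < t0 + T.
      by case/andP: ha; case/andP: hb; case/andP: hs => *; apply/andP; split; lra.
    by apply.
  case: (leP t (t0 + T / 2)) => tm; first exact: (key t (t0 + T / 2)).
  by apply: (key (t0 + T / 2) t) => //; [exact: ltW|rewrite mulrC].
have nn t : t0 - T < t < t0 + T -> 0 <= x t * x (t0 + T / 2).
  move=> ht; case: (ltgtP t t0) => [lt|gt|->]; last by rewrite x0 mul0r.
    by rewrite -per ltW// same//; case/andP: ht => *; apply/andP; split; lra.
  by rewrite ltW// same//; case/andP: ht => *; apply/andP; split; lra.
have := der_at_min (fun t => derM (h t) (der_cst (x (t0 + T / 2)) t))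
  (a := t0 - T) (b := t0 + T) (t := t0).
rewrite x0 mulr0 addr0 mul0r => /(_ _ nn) e.
have : p t0 * x (t0 + T / 2) = 0 by apply: e; apply/andP; split; lra.
by move/eqP; rewrite mulf_eq0 (negbTE p0) (negbTE (nz _ hm)).
Qed.

(** * Zero spacing for an odd force *)

Section OddForce.
Variables (F x p : R -> R) (L T t0 : R).
Hypotheses (hL : lip L F) (oddF : forall a, F (- a) = - F a).
Hypotheses (sol : ode_sol F x p) (T0 : 0 < T).
Hypothesis per : forall t, x (t + T) = x t /\ p (t + T) = p t.
Hypothesis minT : forall T', 0 < T' < T ->
  ~ (forall t, x (t + T') = x t /\ p (t + T') = p t).
Hypotheses (x0 : x t0 = 0) (p0 : p t0 != 0).
Hypothesis energy : forall t, x t = 0 -> p t ^+ 2 = p t0 ^+ 2.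

(* The time translate by t1 - t0 solves the same equation, and so does its
   opposite; compare initial data. *)
Lemma zero_antiperiod t1 : t0 < t1 < t0 + T -> x t1 = 0 ->
  (forall t, x (t + (t1 - t0)) = - x t /\ p (t + (t1 - t0)) = - p t) /\ t1 - t0 = T / 2.
Proof.
move=> /andP[h1 h2] e1.
have sh := ode_sol_shift (t1 - t0) sol.
have et : t0 + (t1 - t0) = t1 by rewrite addrC subrK.
(* Energy leaves only the sign of the momentum open; equal signs would make the shift a period
   shorter than [T]. *)
have [ep|ep] : p t1 = p t0 \/ p t1 = - p t0.
  by have /eqP := energy e1; rewrite eqf_sqr => /orP[] /eqP; [left|right].
  exfalso; apply: (@minT (t1 - t0)); first by apply/andP; split; lra.
  by apply: (ode_unique hL sh sol (t0 := t0)); rewrite et// e1.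
have anti t : x (t + (t1 - t0)) = - x t /\ p (t + (t1 - t0)) = - p t.
  move: t; apply: (ode_unique hL sh (ode_sol_opp oddF sol) (t0 := t0)); rewrite et//.
  by rewrite e1 x0 oppr0.
split=> //.
(* Twice an antiperiod is a period. If it differs from [T], then either it or its excess over [T] is
   a period in (0, T). *)
have per2 t : x (t + (t1 - t0) *+ 2) = x t /\ p (t + (t1 - t0) *+ 2) = p t.
  rewrite mulr2n addrA; have [-> ->] := anti (t + (t1 - t0)).
  by have [-> ->] := anti t; rewrite !opprK.
case: (ltgtP (t1 - t0) (T / 2)) => // hlt; exfalso.
  by apply: (@minT ((t1 - t0) *+ 2)) => //; rewrite mulr2n; apply/andP; split; lra.
apply: (@minT ((t1 - t0) *+ 2 - T)).
  by rewrite mulr2n; apply/andP; split; lra.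
move=> t; have [<- <-] := per (t + ((t1 - t0) *+ 2 - T)).
by rewrite -addrA subrK; exact: per2.
Qed.

(** The antiperiod carries any zero into [t0, t0 + T/2), and a zero there other than [t0] would
    itself have to lie at distance [T / 2] from [t0]. *)
Lemma zeros_half_period t : x t = 0 <-> exists j : int, t = t0 + j%:~R * (T / 2).
Proof.
have [|t1 ht1 e1] := transversal_zero_recurs T0 (fun t => (sol t).1) _ x0 p0.
  by move=> s; exact: (per s).1.
have [anti eT] := zero_antiperiod ht1 e1; rewrite eT in anti.
have inv s : x (s + T / 2) = 0 <-> x s = 0.
  by rewrite (anti s).1; split=> [/eqP|->]; [rewrite oppr_eq0 => /eqP|rewrite oppr0].
split=> [xt|[j ->]]; last by apply/(invariant_intmul inv).
have T20 : 0 < T / 2 by lra.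
have [j [r [er /andP[r1 r2]]]] := floor_reduction t t0 T20.
exists j; rewrite er; congr (_ + _); apply/eqP; rewrite eq_le r1 andbT leNgt.
apply/negP => r0; have xr : x r = 0 by apply/(invariant_intmul inv j); rewrite -er.
by have [|_ ] := zero_antiperiod (t1 := r) _ xr; [apply/andP; split|]; lra.
Qed.

End OddForce.

End PeriodicOrbits.

(** * The motion in lambda *)

Section BoundedLipschitz.
Variable R : realType.
Implicit Types (f g : R -> R) (a b c x y t L M : R).

(** Boundedness makes the class closed under products, and it is the second requirement of
    [ode_exists]. *)
Definition bounded_lip f : Prop := exists L B, lip L f /\ forall a, `|f a| <= B.

Lemma bounded_lip_cst c : bounded_lip (fun=> c).
Proof. by exists 0, `|c|; split=> // a b; rewrite subrr normr0 mul0r. Qed.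

Lemma bounded_lipD f g : bounded_lip f -> bounded_lip g -> bounded_lip (fun x => f x + g x).
Proof.
move=> [L [B [hL hB]]] [L' [B' [hL' hB']]]; exists (L + L'), (B + B'); split=> [a b|a].
  have -> : f a + g a - (f b + g b) = (f a - f b) + (g a - g b) by ring.
  by rewrite mulrDl; apply: le_trans (ler_normD _ _) _; apply: lerD; [exact: hL|exact: hL'].
by apply: le_trans (ler_normD _ _) _; apply: lerD.
Qed.

Lemma bounded_lipM f g : bounded_lip f -> bounded_lip g -> bounded_lip (fun x => f x * g x).
Proof.
move=> [L [B [hL hB]]] [L' [B' [hL' hB']]]; exists (L * B' + B * L'), (B * B'); split=> [a b|a].
  have -> : f a * g a - f b * g b = (f a - f b) * g a + f b * (g a - g b) by ring.
  rewrite [X in _ <= X]mulrDl; apply: le_trans (ler_normD _ _) _; rewrite !normrM.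
  apply: lerD; first by rewrite mulrAC; apply: ler_pM.
  by rewrite -mulrA; apply: ler_pM.
by rewrite normrM; apply: ler_pM.
Qed.

Lemma der_bounded_lip f (f' : R -> R) a b L : (forall t, is_derive t 1 f (f' t)) ->
  (forall t, a <= t <= b -> `|f' t| <= L) ->
  forall x y, a <= x <= b -> a <= y <= b -> `|f x - f y| <= L * `|x - y|.
Proof.
move=> h hL x y; wlog xy : x y / x <= y.
  move=> H hx hy; case: (leP x y) => [xy|/ltW yx]; first exact: H.
  by rewrite distrC [X in _ * X]distrC; exact: H.
move: xy; rewrite le_eqVlt => /orP[/eqP-> _ _|xy]; first by rewrite !subrr normr0 mulr0.
move=> /andP[ax xb] /andP[ay yb].
have [c /andP[c1 c2] e] := mvt h xy.
rewrite distrC e normrM [X in _ <= _ * X]distrC ler_wpM2r// hL//.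
by apply/andP; split; lra.
Qed.

Lemma bounded_lip_sin : bounded_lip (@sin R).
Proof.
exists 1, 1; split=> [x y|x]; last exact: sin_max.
apply: (@der_bounded_lip _ _ (Num.min x y) (Num.max x y) 1 (@is_derive_sin R)).
- by move=> t _; exact: cos_max.
- by rewrite ge_min le_max lexx.
- by rewrite ge_min le_max lexx !orbT.
Qed.

Lemma bounded_lip_cos : bounded_lip (@cos R).
Proof.
exists 1, 1; split=> [x y|x]; last exact: cos_max.
apply: (@der_bounded_lip _ _ (Num.min x y) (Num.max x y) 1 (@is_derive_cos R)).
- by move=> t _; rewrite normrN; exact: sin_max.
- by rewrite ge_min le_max lexx.
- by rewrite ge_min le_max lexx !orbT.
Qed.

Definition clamp M x : R := Num.max (- M) (Num.min x M).

Lemma clamp_id M x : - M <= x <= M -> clamp M x = x.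
Proof. by move=> /andP[h1 h2]; rewrite /clamp min_l// max_r. Qed.

Lemma clamp_cases M x : 0 <= M -> [\/ x < - M /\ clamp M x = - M,
  - M <= x <= M /\ clamp M x = x | M < x /\ clamp M x = M].
Proof.
move=> M0; case: (leP (- M) x) => h1.
  case: (leP x M) => h2; first by apply: Or32; rewrite clamp_id ?h1 ?h2.
  by apply: Or33; rewrite /clamp min_r ?max_r ?(ltW h2)//; lra.
by apply: Or31; rewrite /clamp min_l ?max_l ?(ltW h1)//; lra.
Qed.

Lemma clamp_bound M x : 0 <= M -> - M <= clamp M x <= M.
Proof.
by move=> M0; case: (clamp_cases x M0) => -[h ->] //; apply/andP; split; lra.
Qed.

Lemma clampN M x : 0 <= M -> clamp M (- x) = - clamp M x.
Proof.
move=> M0; case: (clamp_cases x M0) => -[h ->]; case: (clamp_cases (- x) M0) => -[h' ->] //;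
  rewrite ?opprK; lra.
Qed.

Lemma clamp_lip M : 0 <= M -> lip 1 (clamp M).
Proof.
move=> M0 x y; rewrite mul1r; wlog xy : x y / x <= y.
  by move=> H; case: (leP x y) => [/H//|/ltW/H]; rewrite distrC [X in _ <= X]distrC.
rewrite distrC [X in _ <= X]distrC [X in _ <= X]ger0_norm ?subr_ge0// ler_norml.
by case: (clamp_cases x M0) => -[h ->]; case: (clamp_cases y M0) => -[h' ->];
  apply/andP; split; lra.
Qed.

Lemma bounded_lip_exp_clamp M : 0 <= M -> bounded_lip (fun x => expR (clamp M x)).
Proof.
move=> M0; have hb x : `|expR (clamp M x)| <= expR M.
  by rewrite ger0_norm ?expR_ge0// ler_expR; have /andP[] := clamp_bound x M0.
exists (expR M), (expR M); split=> // x y.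
apply: (le_trans (@der_bounded_lip _ _ (- M) M (expR M) (@is_derive_expR R) _ _ _ _ _)).
- by move=> t /andP[_ tM]; rewrite ger0_norm ?expR_ge0// ler_expR.
- exact: clamp_bound.
- exact: clamp_bound.
- by rewrite ler_wpM2l ?expR_ge0//; have := clamp_lip M0 x y; rewrite mul1r.
Qed.

Lemma bounded_lip_expN_clamp M : 0 <= M -> bounded_lip (fun x => expR (- clamp M x)).
Proof.
move=> M0; have [L [B [hL hB]]] := bounded_lip_exp_clamp M0.
exists L, B; split=> [x y|x]; last by rewrite -clampN.
by rewrite -!clampN//; apply: le_trans (hL _ _) _; rewrite opprK addrC distrC.
Qed.

End BoundedLipschitz.

(** * Confinement and zeros of lambda *)

Section Lambda.
Variable R : realType.
Variables (d m1 m2 h g : R).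
Hypotheses (d0 : 0 < d) (m10 : 0 < m1) (m20 : 0 < m2) (h0 : h < 0).
Implicit Types (t l p x : R).

Let a := d * (m1 + m2).
Let b := - (h * d ^+ 2).
Let a0 : 0 < a. Proof. by rewrite mulr_gt0// addr_gt0. Qed.
Let b0 : 0 < b. Proof. by rewrite oppr_gt0 nmulr_rlt0// exprn_gt0. Qed.

Lemma HlamE l p : Hlam d m1 m2 h l p = p ^+ 2 / 2 + (b * coshR l ^+ 2 - a * coshR l).
Proof. by rewrite /Hlam /a /b; ring. Qed.

Lemma dHlamE l : dHlam d m1 m2 h l = (2 * b * coshR l - a) * sinhR l.
Proof. by rewrite /dHlam /a /b; ring. Qed.

Lemma is_derive_Vlam l :
  is_derive l 1 (fun x => b * coshR x ^+ 2 - a * coshR x) (dHlam d m1 m2 h l).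
Proof.
have hc := is_derive_coshR l.
have -> : dHlam d m1 m2 h l =
  b * (sinhR l * coshR l + coshR l * sinhR l) - a * sinhR l by rewrite dHlamE; ring.
exact: (derB (derZ b (derM hc hc)) (derZ a hc)).
Qed.

Lemma lam_energy (l pl : R -> R) t (s : R) : lam_sol d m1 m2 h l pl ->
  Hlam d m1 m2 h (l t) (pl t) = Hlam d m1 m2 h (l s) (pl s).
Proof. by move=> sol; rewrite !HlamE; exact: (potential_energy is_derive_Vlam sol). Qed.

(** The first bound confines the orbits of level [- g]; the second fixes the sign of the force
    further out, so that the potential of a frozen force keeps rising. *)
Lemma lam_confined : exists2 M, 0 < M & forall x, M <= `|x| ->
  - g < b * coshR x ^+ 2 - a * coshR x /\ 0 < 2 * b * coshR x - a.
Proof.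
have C0 : 0 <= (a + `|g|) / b by rewrite divr_ge0 ?addr_ge0 ?(ltW a0) ?(ltW b0).
(* Since cosh x >= (1 + |x|) / 2, this radius gives b cosh x - a >= |g| + b; multiplying by cosh x
   >= 1 yields a potential above [- g]. *)
exists (2 * ((a + `|g|) / b + 1)); first lra.
move=> x hx; have c1 := coshR_ge1 x; have c2 := coshR_ge_half x.
have h1 : (a + `|g|) / b + 1 <= coshR x by lra.
have h2 : a + `|g| + b <= b * coshR x.
  by rewrite -lerBrDr in h1; rewrite ler_pdivrMr// mulrBl mul1r in h1; lra.
have g1 : - g <= `|g| by rewrite -normrN ler_norm.
have g0 := normr_ge0 g; have := b0; have := a0 => ? ?.
by split; nra.
Qed.

Lemma lam_truncation M : 0 < M -> let F x := - dHlam d m1 m2 h (clamp M x) in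
  (exists L B, lip L F /\ forall x, `|F x| <= B) /\ (forall x, F (- x) = - F x).
Proof.
move=> /ltW M0 F; split; last first.
  by move=> x; rewrite /F clampN// !dHlamE coshRN sinhRN mulrN.
have -> : F = fun x => a * ((expR (clamp M x) + -1 * expR (- clamp M x)) * 2^-1) +
   (- (2 * b)) * (((expR (clamp M x) + expR (- clamp M x)) * 2^-1) *
      ((expR (clamp M x) + -1 * expR (- clamp M x)) * 2^-1)).
  by apply/funext => x; rewrite /F dHlamE /coshR /sinhR; field.
have e1 := bounded_lip_exp_clamp M0; have e2 := bounded_lip_expN_clamp M0.
have c c' := @bounded_lip_cst R c'.
by repeat first [exact: e1 | exact: e2 | exact: c | apply: bounded_lipD | apply: bounded_lipM].
Qed.

(* The force is frozen outside a large interval; energy conservation for the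
   frozen force keeps the orbits of energy -g inside that interval. *)
Lemma lam_effective_force : exists F L, [/\ lip L F, (forall x, F (- x) = - F x),
  (forall l pl : R -> R, lam_sol d m1 m2 h l pl -> Hlam d m1 m2 h (l 0) (pl 0) = - g ->
     ode_sol F l pl) &
  (forall l0 p0, Hlam d m1 m2 h l0 p0 = - g -> exists l pl : R -> R,
     lam_sol d m1 m2 h l pl /\ l 0 = l0 /\ pl 0 = p0)].
Proof.
have [M M0 hM] := lam_confined.
have M1 : 0 < M + 1 by lra.
pose F x := - dHlam d m1 m2 h (clamp (M + 1) x).
have [[L [B [hL hB]]] hodd] := lam_truncation M1.
have inside l p : Hlam d m1 m2 h l p = - g -> `|l| < M.
  rewrite HlamE => e; rewrite ltNge; apply/negP => /hM[h1 _].
  by have := sqr_ge0 p; lra.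
have FE x : `|x| < M -> F x = - dHlam d m1 m2 h x.
  by rewrite ltr_norml => /andP[x1 x2]; rewrite /F clamp_id//; apply/andP; split; lra.
exists F, L; split => //.
  move=> l pl sol e t; have [s1 s2] := sol t; split => //.
  by rewrite FE//; apply: (inside _ (pl t)); rewrite (lam_energy t 0 sol).
move=> l0 p0 e0; have [x [p [sol [e1 e2]]]] := ode_exists l0 p0 hL hB.
have cF : continuous (fun x => - F x).
  by move=> x'; apply: continuousN; exact: (lip_continuous hL).
have [V [V0 hV]] := continuous_has_primitive (b * coshR 0 ^+ 2 - a * coshR 0) cF.
have VE y : - (M + 1) < y < M + 1 -> V y = b * coshR y ^+ 2 - a * coshR y.
  move=> hy.
  have hd t : - (M + 1) < t < M + 1 ->
      is_derive t 1 (fun y => V y - (b * coshR y ^+ 2 - a * coshR y)) 0.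
    move=> /andP[t1 t2]; have := derB (hV t) (is_derive_Vlam t).
    by rewrite /F opprK clamp_id ?subrr// !ltW.
  have hz : - (M + 1) < 0 < M + 1 by apply/andP; split; lra.
  have := der0_cst_on hd hy hz; rewrite V0 subrr => /eqP.
  by rewrite subr_eq0 => /eqP.
have VM y : M <= `|y| -> - g < V y.
  move=> hy; have VMM z : `|z| = M -> - g < V z.
    move=> hz; rewrite VE; first by apply: (hM z _).1; rewrite hz.
    by rewrite -ltr_norml hz; lra.
  have sgn t : M <= `|t| -> 0 < (2 * b * coshR (clamp (M + 1) t) - a).
    move=> ht; apply: (hM _ _).2.
    case: (clamp_cases t (ltW M1)) => -[_ ->] //; first by rewrite normrN ger0_norm; lra.
    by rewrite ger0_norm; lra.
  have cpos t : M <= t -> 0 < clamp (M + 1) t.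
    by move=> ht; case: (clamp_cases t (ltW M1)) => -[? ->]; lra.
  move: hy; case: (ger0P y) => y0 hy.
    apply: lt_le_trans (VMM M _) _; first by rewrite ger0_norm// ltW.
    apply: (der_ge0_homo hV _ hy) => t /andP[t1 t2]; rewrite /F opprK dHlamE.
    rewrite mulr_ge0//; first by rewrite ltW// sgn// ger0_norm; lra.
    by rewrite ltW// sinhR_gt0// cpos// ltW.
  apply: lt_le_trans (VMM (- M) _) _; first by rewrite normrN ger0_norm// ltW.
  rewrite -lerN2; have hy' : y <= - M by lra.
  apply: (der_ge0_homo (fun t => derN (hV t)) _ hy') => t /andP[t1 t2].
  rewrite /F opprK dHlamE -mulrN mulr_ge0//.
    by rewrite ltW// sgn// ler0_norm; lra.
  by rewrite -sinhRN -clampN ?(ltW M1)// ltW// sinhR_gt0// cpos; lra.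
have solV : ode_sol (fun x => - (- F x)) x p by move=> t; rewrite opprK; exact: sol.
have en t := potential_energy hV solV t 0.
have x0M : `|l0| < M by exact: inside e0.
have xM t : `|x t| < M.
  rewrite ltNge; apply/negP => /VM; have := en t; rewrite e1 e2 (VE l0).
    by rewrite -HlamE e0; have := sqr_ge0 (p t); lra.
  by rewrite -ltr_norml; lra.
exists x, p; split=> // t; have [s1 s2] := sol t; split=> //.
by rewrite -FE.
Qed.

Hypothesis reg : regular_lam d m1 m2 h (- g).

Section Orbit.
Variables (l pl : R -> R) (T : R).
Hypotheses (sol : lam_sol d m1 m2 h l pl) (lev : Hlam d m1 m2 h (l 0) (pl 0) = - g).
Hypotheses (T0 : 0 < T) (per : forall t, l (t + T) = l t /\ pl (t + T) = pl t).
Hypothesis top : Hlam d m1 m2 h 0 0 <= - g.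

(* Otherwise cosh l takes at its extrema two distinct values c1, c2 > 1 with
   b c^2 - a c + g = b (c - c1) (c - c2), which is positive at c = 1. *)
Lemma lam_reaches_zero : exists t, l t = 0.
Proof.
apply: contrapT => no.
have nz t : l t != 0 by apply/eqP => e; apply: no; exists t.
have lev' t : Hlam d m1 m2 h (l t) (pl t) = - g by rewrite (lam_energy t 0 sol).
have [tm [tM [bd [em eM]]]] :=
  periodic_extrema T0 (fun t => (sol t).1) (fun t => (per t).1).
(* A constant orbit would be an equilibrium, which a regular level excludes. *)
have ne : l tm != l tM.
  apply/eqP => e; have cst t : l t = l tm.
    by apply/eqP; rewrite eq_le {1}e; have /andP[-> ->] := bd t.
  have dl t : is_derive t 1 l 0.
    by rewrite (_ : l = fun=> l tm); [exact: der_cst|apply/funext].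
  have p0 t : pl t = 0 by apply: (is_derive_unique (sol t).1 (dl t)).
  have dp : is_derive tm 1 pl 0.
    by rewrite (_ : pl = fun=> 0); [exact: der_cst|apply/funext].
  have /eqP := is_derive_unique (sol tm).2 dp; rewrite oppr_eq0 => /eqP ed.
  by case: (reg (lev' tm)) => /eqP.
(* Having no zero, [l] keeps one sign, and on each half-line cosh is injective. *)
have cne : coshR (l tm) != coshR (l tM).
  have mono x y : 0 < x -> x < y -> coshR x < coshR y.
    move=> x0 xy; apply: (der_gt0_homo (@is_derive_coshR R) _ xy) => t /andP[t1 _].
    exact: sinhR_gt0 (lt_trans x0 t1).
  have /andP[_ hle] := bd tm; have {hle}lt : l tm < l tM by rewrite lt_neqAle ne.
  have cl : continuous l := der_continuous (fun t => (sol t).1).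
  case: (continuous_sign cl nz) => sg.
    by rewrite lt_eqF// mono.
  by rewrite -coshRN -[coshR (l tM)]coshRN gt_eqF// mono// ?ltrN2// oppr_gt0.
have c1 t : 1 < coshR (l t).
  have := coshR_ge_half `|l t|; have e : coshR `|l t| = coshR (l t).
    by case: ger0P => // _; rewrite coshRN.
  rewrite lt_neqAle coshR_ge1 andbT => _; apply/eqP => e1.
  have mono : coshR 0 < coshR `|l t|.
    have l0 : 0 < `|l t| by rewrite normr_gt0.
    apply: (der_gt0_homo (@is_derive_coshR R) _ l0) => u /andP[u0 _].
    exact: sinhR_gt0.
  by move: mono; rewrite coshR0 e -e1 ltxx.
have := lev' tm; have := lev' tM; have := top.
rewrite !HlamE em eM coshR0 expr0n/= mul0r !add0r.
move: cne (c1 tm) (c1 tM); move: (coshR _) (coshR _) => x y xy x1 y1 h1 h2 h3.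
have h4 : (b * (x + y) - a) = 0.
  apply/eqP; have : (b * (x + y) - a) * (x - y) = 0 by nra.
  by move/eqP; rewrite mulf_eq0 [x - y == 0]subr_eq0 [x == y]eq_sym (negbTE xy) orbF.
have ea : a = b * (x + y) by lra.
have : 0 < b * ((x - 1) * (y - 1)) by rewrite !mulr_gt0 ?subr_gt0.
by move: h1 h2 h3; rewrite ea => h1 h2 h3; lra.
Qed.

Hypothesis minT : forall T', 0 < T' < T ->
  ~ (forall t, l (t + T') = l t /\ pl (t + T') = pl t).

Lemma lam_zero_times : exists u0, forall t, l t = 0 <-> exists j : int, t = u0 + j%:~R * (T / 2).
Proof.
have [u0 e0] := lam_reaches_zero; exists u0.
have lev' t : Hlam d m1 m2 h (l t) (pl t) = - g by rewrite (lam_energy t 0 sol).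
have [F [L [hL hodd hF _]]] := lam_effective_force.
apply: (zeros_half_period hL hodd (hF _ _ sol lev) T0 per minT e0).
  (* The force vanishes at lambda = 0, so regularity forces a nonzero momentum there. *)
  have := lev' u0; rewrite e0 => /reg; rewrite dHlamE sinhR0 mulr0 eqxx.
  by case.
by move=> t et; have := lev' t; have := lev' u0; rewrite e0 et !HlamE; lra.
Qed.

End Orbit.

End Lambda.

(** * The motion in nu *)

Section Angles.
Variable R : realType.
Implicit Types (x c t : R).

Lemma sin_add_2pi_int x (k : int) : sin (x + k%:~R * (2 * pi)) = sin x.
Proof.
apply/(@invariant_intmul R (fun t => sin t = sin x)) => // t.
by rewrite mulr_natl sinD2pi.
Qed.

Lemma cos_add_2pi_int x (k : int) : cos (x + k%:~R * (2 * pi)) = cos x.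
Proof.
apply/(@invariant_intmul R (fun t => cos t = cos x)) => // t.
by rewrite mulr_natl cosD2pi.
Qed.

Lemma sinNpihalf : sin (- (pi / 2)) = -1 :> R.
Proof. by rewrite sinN sin_pihalf. Qed.

Lemma cosNpihalf : cos (- (pi / 2)) = 0 :> R.
Proof. by rewrite cosN cos_pihalf. Qed.

Lemma int_parity (j : int) : exists i, j = 2 * i \/ j = 2 * i + 1.
Proof.
exists (j %/ 2)%Z; have := divz_eq j 2; have := ltz_mod j (d := 2) isT.
have := modz_ge0 j (d := 2) isT; lia.
Qed.

Lemma dvdz2_odd (i : int) : (2 %| 2 * i + 1)%Z = false.
Proof. by apply/negbTE; lia. Qed.

Lemma cos_eq0_multiple x : cos x = 0 <-> exists j : int, x = - (pi / 2) + j%:~R * pi.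
Proof.
have inv t : cos (t + pi) = 0 <-> cos t = 0.
  by rewrite cosDpi; split=> [/eqP|->]; [rewrite oppr_eq0 => /eqP|rewrite oppr0].
split=> [h|[j ->]]; last by apply/(invariant_intmul inv); exact: cosNpihalf.
have [j [r [er /andP[r1 r2]]]] := floor_reduction x (- (pi / 2)) (pi_gt0 R).
exists j; rewrite er; congr (_ + _); apply/eqP; rewrite eq_le r1 andbT leNgt.
apply/negP => r0; have cr : cos r = 0 by apply/(invariant_intmul inv j); rewrite -er.
have := cos_gt0_pihalf (x := r); rewrite cr ltxx r0 /= => /(_ _).
by case: ltP => [_ /(_ isT)//|]; lra.
Qed.

Lemma sin_multiple (j : int) : sin (- (pi / 2) + j%:~R * pi) = if (2 %| j)%Z then -1 else 1 :> R.
Proof.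
have [i [->|->]] := int_parity j.
  have -> : (2 %| 2 * i)%Z by rewrite dvdz_mulr.
  have -> : (2 * i)%:~R * pi = i%:~R * (2 * pi) :> R by rewrite intrM; ring.
  by rewrite sin_add_2pi_int sinNpihalf.
rewrite dvdz2_odd.
have -> : - (pi / 2) + (2 * i + 1)%:~R * pi = pi / 2 + i%:~R * (2 * pi) :> R.
  by rewrite intrD intrM; field.
by rewrite sin_add_2pi_int sin_pihalf.
Qed.

Lemma eqmod2pi_Npihalf x : eqmod2pi x (- (pi / 2)) <-> sin x = -1.
Proof.
split=> [[k ->]|h]; first by rewrite sin_add_2pi_int sinNpihalf.
have /cos_eq0_multiple[j e] : cos x = 0 by apply: sin1cos0; rewrite h normrN1.
move: h; rewrite e sin_multiple; have [i [ej|ej]] := int_parity j; rewrite ej.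
  by move=> _; exists i; rewrite intrM; ring.
by rewrite dvdz2_odd; lra.
Qed.

Lemma eqmod2pi_pihalf x : eqmod2pi x (pi / 2) <-> sin x = 1.
Proof.
split=> [[k ->]|h]; first by rewrite sin_add_2pi_int sin_pihalf.
have /cos_eq0_multiple[j e] : cos x = 0 by apply: sin1cos0; rewrite h normr1.
move: h; rewrite e sin_multiple; have [i [ej|ej]] := int_parity j; rewrite ej.
  by rewrite dvdz_mulr//=; lra.
by move=> _; exists i; rewrite intrD intrM; field.
Qed.

Lemma sin_of_cos0 x : cos x = 0 -> sin x = 1 \/ sin x = -1.
Proof.
by move=> /cos_eq0_multiple[j ->]; rewrite sin_multiple; case: ifP; [right|left].
Qed.

Lemma eqmod2pi_cos0 x :
  (eqmod2pi x (pi / 2) \/ eqmod2pi x (- (pi / 2))) <-> cos x = 0.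
Proof.
split=> [[/eqmod2pi_pihalf h|/eqmod2pi_Npihalf h]|].
- by apply: sin1cos0; rewrite h normr1.
- by apply: sin1cos0; rewrite h normrN1.
by case/sin_of_cos0 => h; [left; apply/eqmod2pi_pihalf|right; apply/eqmod2pi_Npihalf].
Qed.

(** Here [c + c] is an odd multiple of pi, so the reflection is [pi - x] up to full turns. *)
Lemma reflect_sin c x : cos c = 0 -> sin (c + c - x) = sin x.
Proof.
move=> h; rewrite sinB sinD cosD h !mulr0 !mul0r addr0 sub0r mul0r sub0r mulNr opprK.
by have := cos2Dsin2 c; rewrite h expr0n/= add0r expr2 => ->; rewrite mul1r.
Qed.

Lemma reflect_cos c x : cos c = 0 -> cos (c + c - x) = - cos x.
Proof.
move=> h; rewrite cosB sinD cosD h !mulr0 !mul0r addr0 sub0r mul0r addr0 mulNr.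
by have := cos2Dsin2 c; rewrite h expr0n/= add0r expr2 => ->; rewrite mul1r.
Qed.

End Angles.

(** * Winding and oscillating motion in nu *)

Section Nu.
Variable R : realType.
Variables (d m1 m2 h g : R).
Hypotheses (d0 : 0 < d) (h0 : h < 0).
Implicit Types (t x y : R).

Let e := d * (m1 - m2).
Let b := - (h * d ^+ 2).
Let b0 : 0 < b. Proof. by rewrite oppr_gt0 nmulr_rlt0// exprn_gt0. Qed.

Lemma HnuE x (p : R) : Hnu d m1 m2 h x p = p ^+ 2 / 2 + (e * sin x - b * sin x ^+ 2).
Proof. by rewrite /Hnu /e /b; ring. Qed.

Lemma dHnuE x : dHnu d m1 m2 h x = (e - 2 * b * sin x) * cos x.
Proof. by rewrite /dHnu /e /b; ring. Qed.

Lemma is_derive_Vnu x : is_derive x 1 (fun y => e * sin y - b * sin y ^+ 2) (dHnu d m1 m2 h x).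
Proof.
have hs := @is_derive_sin R x.
have -> : dHnu d m1 m2 h x = e * cos x - b * (cos x * sin x + sin x * cos x).
  by rewrite dHnuE; ring.
exact: (derB (derZ e hs) (derZ b (derM hs hs))).
Qed.

Lemma nu_energy (v pv : R -> R) t (s : R) : nu_sol d m1 m2 h v pv ->
  Hnu d m1 m2 h (v t) (pv t) = Hnu d m1 m2 h (v s) (pv s).
Proof. by move=> sol; rewrite !HnuE; exact: (potential_energy is_derive_Vnu sol). Qed.

Lemma nu_force_bounded_lip : bounded_lip (fun x => - dHnu d m1 m2 h x).
Proof.
have -> : (fun x => - dHnu d m1 m2 h x) =
    fun x => (- e + 2 * b * sin x) * cos x.
  by apply/funext => x; rewrite dHnuE; ring.
have s := bounded_lip_sin R; have c := bounded_lip_cos R.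
have k k' := @bounded_lip_cst R k'.
by repeat first [exact: s | exact: c | exact: k | apply: bounded_lipD | apply: bounded_lipM].
Qed.

Lemma nu_exists x0 p0 : exists v pv : R -> R, nu_sol d m1 m2 h v pv /\ v 0 = x0 /\ pv 0 = p0.
Proof. by have [L [B [hL hB]]] := nu_force_bounded_lip; exact: (ode_exists x0 p0 hL hB). Qed.

Lemma nu_unique (v pv w pw : R -> R) t0 : nu_sol d m1 m2 h v pv -> nu_sol d m1 m2 h w pw ->
  v t0 = w t0 -> pv t0 = pw t0 -> forall t, v t = w t /\ pv t = pw t.
Proof.
by have [L [B [hL hB]]] := nu_force_bounded_lip; exact: (ode_unique hL).
Qed.

Lemma nu_sol_shift (v pv : R -> R) (s : R) : nu_sol d m1 m2 h v pv ->
  nu_sol d m1 m2 h (fun t => v (t + s)) (fun t => pv (t + s)).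
Proof. exact: (@ode_sol_shift R (fun x => - dHnu d m1 m2 h x)). Qed.

Lemma nu_sol_translate (v pv : R -> R) (k : int) : nu_sol d m1 m2 h v pv ->
  nu_sol d m1 m2 h (fun t => v t + k%:~R * (2 * pi)) pv.
Proof.
move=> sol t; have [h1 h2] := sol t; split.
  by have := derD h1 (der_cst (k%:~R * (2 * pi)) t); rewrite addr0.
by rewrite dHnuE cos_add_2pi_int sin_add_2pi_int -dHnuE.
Qed.

Lemma nu_sol_reflect (v pv : R -> R) (c : R) : cos c = 0 -> nu_sol d m1 m2 h v pv ->
  nu_sol d m1 m2 h (fun t => c + c - v t) (fun t => - pv t).
Proof.
move=> hc sol t; have [h1 h2] := sol t; split.
  by have := derB (der_cst (c + c) t) h1; rewrite sub0r.
have -> : - dHnu d m1 m2 h (c + c - v t) = - - dHnu d m1 m2 h (v t).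
  by rewrite !dHnuE reflect_sin// reflect_cos// mulrN.
exact: derN.
Qed.

(** In [nu_period] the integer may vary with time; uniqueness, applied to the translated solution,
    fixes one [k] for all times. *)
Lemma nu_sol_periodic (v pv : R -> R) (T : R) : nu_sol d m1 m2 h v pv ->
  eqmod2pi (v (0 + T)) (v 0) -> pv (0 + T) = pv 0 ->
  exists k : int, forall t, v (t + T) = v t + k%:~R * (2 * pi) /\ pv (t + T) = pv t.
Proof.
move=> sol [k ek] ep; exists k.
exact: (nu_unique (t0 := 0) (nu_sol_shift T sol) (nu_sol_translate k sol)).
Qed.

Hypothesis reg : regular_nu d m1 m2 h g.

(** A point where the potential reaches [g] would be a maximum, hence a critical point with zero
    momentum on a regular level. *)
Lemma nu_regular_max : (forall x, Hnu d m1 m2 h x 0 <= g) -> forall x, Hnu d m1 m2 h x 0 < g.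
Proof.
move=> hle x; rewrite lt_neqAle hle andbT; apply/eqP => ex.
have [|/eqP//] := reg ex; apply/negP; rewrite negbK; apply/eqP.
have hx : x - 1 < x < x + 1 by apply/andP; split; lra.
apply: (der_at_max is_derive_Vnu hx) => y _.
by have := hle y; rewrite -ex !HnuE; lra.
Qed.

Section Orbit.
Variables (v pv : R -> R) (T : R).
Hypotheses (sol : nu_sol d m1 m2 h v pv) (lev : Hnu d m1 m2 h (v 0) (pv 0) = g).
Hypotheses (T0 : 0 < T) (per : forall t, eqmod2pi (v (t + T)) (v t) /\ pv (t + T) = pv t).
Hypothesis minT : forall T', 0 < T' < T ->
  ~ (forall t, eqmod2pi (v (t + T')) (v t) /\ pv (t + T') = pv t).

Let lev' t : Hnu d m1 m2 h (v t) (pv t) = g.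
Proof. by rewrite (nu_energy t 0 sol). Qed.

Let cv : continuous v := der_continuous (fun t => (sol t).1).

(** Time reversal about a passage [t0] through -pi/2, combined with the reflection about that angle,
    preserves the data at [t0]. Hence v(t0 + s) + v(t0 - s) = -pi, and an advance of 2 pi per period
    puts the passage through pi/2 at t0 + T/2. *)
Lemma nu_winding_times_pos : (forall t, 0 < pv t) ->
  exists t0, (forall t, cos (v t) = 0 <-> exists i : int, t = t0 + i%:~R * (T / 2)) /\
    forall i : int, sin (v (t0 + i%:~R * (T / 2))) = if (2 %| i)%Z then -1 else 1.
Proof.
move=> pos; have pi0 := pi_gt0 R.
have incr x y : x < y -> v x < v y.
  by move=> xy; apply: (der_gt0_homo (fun t => (sol t).1) _ xy) => t _; exact: pos.
have inj x y : v x = v y -> x = y.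
  by move=> exy; case: (ltgtP x y) => // /incr; rewrite exy ltxx.
have [k hk] : exists k : int, forall t, v (t + T) = v t + k%:~R * (2 * pi) /\ pv (t + T) = pv t.
  by apply: nu_sol_periodic => //; have [] := per 0.
have k0 : 0 < k.
  have : v 0 < v (0 + T) by apply: incr; rewrite add0r.
  by rewrite (hk 0).1 ltrDl pmulr_lgt0 ?ltr0z// mulr_gt0.
pose c := k%:~R * (2 * pi) : R.
have c0 : 0 < c by rewrite mulr_gt0 ?ltr0z// mulr_gt0.
have vj t (j : int) : v (t + j%:~R * T) = v t + j%:~R * c.
  (* Removing the mean drift leaves a [T]-periodic function. *)
  pose w t := v t - t * (c / T).
  have := @invariant_intmul R (fun s => w s = w t) T _ j t.
  have -> : (w (t + j%:~R * T) = w t) = (v (t + j%:~R * T) = v t + j%:~R * c).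
    rewrite /w propeqE; have -> : (t + j%:~R * T) * (c / T) = t * (c / T) + j%:~R * c.
      by field; rewrite gt_eqF.
    by split=> ?; lra.
  move=> H; apply H => // s; rewrite /w (hk s).1 -/c.
  by have -> : (s + T) * (c / T) = s * (c / T) + c by [field; rewrite gt_eqF]; split=> <-; ring.
have surj y : exists t, v t = y.
  have [j [r [-> /andP[r1 r2]]]] := floor_reduction y (v 0) c0.
  have [|s _ <-] := ivt_le (f := v) (a := 0) (b := T) (c := r) cv (ltW T0).
    by left; rewrite r1 -(add0r T) (hk 0).1 ltW.
  by exists (s + j%:~R * T); rewrite vj.
have [t0 e0] := surj (- (pi / 2)); exists t0.
have sqE t s : sin (v t) = sin (v s) -> pv t = pv s.
  move=> es; have := lev' t; rewrite -(lev' s) !HnuE es => /addIr eq.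
  have := pos t; have := pos s => p1 p2; have : (pv t - pv s) * (pv t + pv s) = 0 by lra.
  by move/eqP; rewrite mulf_eq0 subr_eq0 => /orP[/eqP//|]; rewrite gt_eqF// addr_gt0.
(* With [k] at least 2 the first full turn would end before time [T]; there energy and the sign of
   [pv] restore the momentum, which gives a smaller period. *)
have k1 : k = 1.
  apply/eqP; rewrite eq_le [1 <= k](_ : _ = (0 < k))// k0 andbT leNgt; apply/negP => k2.
  have cpi : 2 * pi < c.
    by rewrite -[X in X < _]mul1r ltr_pM2r ?mulr_gt0// -[1]/(1%:~R) ltr_int.
  have [||t1 /andP[a1 a2] e1] := ivt_le (f := v) (a := t0) (b := t0 + T) (c := v t0 + 2 * pi) cv.
  - by rewrite lerDl ltW.
  - by left; rewrite (hk t0).1 -/c; apply/andP; split; lra.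
  have es : sin (v t1) = sin (v t0).
    by rewrite e1 -[2 * pi]mul1r (sin_add_2pi_int (v t0) 1).
  apply: (@minT (t1 - t0)).
    apply/andP; split; rewrite ?subr_gt0 ?ltrBlDr.
      by rewrite lt_neqAle a1 andbT; apply/eqP => e2; move: e1; rewrite -e2; lra.
    rewrite [T + t0]addrC lt_neqAle a2 andbT; apply/eqP => e2.
    by move: e1; rewrite e2 (hk t0).1 -/c; lra.
  have et : t0 + (t1 - t0) = t1 by rewrite addrC subrK.
  move=> t; have [] := nu_unique (t0 := t0) (nu_sol_shift (t1 - t0) sol)
    (nu_sol_translate 1 sol) _ _ t.
  - by rewrite et e1 mul1r.
  - by rewrite et; exact: sqE.
  - by move=> q1 q2; split=> //; exists 1.
have cE : c = 2 * pi by rewrite /c k1 mul1r.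
have half : v (t0 + T / 2) = - (pi / 2) + pi.
  (* The argument of [v] is the reversed time [t0 + t0 - t]. *)
  have rs : nu_sol d m1 m2 h (fun t => (- (pi / 2)) + (- (pi / 2)) - v (- (t + - (t0 + t0))))
      (fun t => - - pv (- (t + - (t0 + t0)))).
    have rv : nu_sol d m1 m2 h (fun t => v (- (t + - (t0 + t0))))
        (fun t => - pv (- (t + - (t0 + t0)))).
      exact: (ode_sol_shift (- (t0 + t0))
        (@ode_sol_reverse R (fun x => - dHnu d m1 m2 h x) v pv sol)).
    exact: (nu_sol_reflect (cosNpihalf R) rv).
  have et : - (t0 + - (t0 + t0)) = t0 by ring.
  have [|| eh _] := nu_unique (t0 := t0) sol rs _ _ (t0 + T / 2).
  - by rewrite et e0; ring.
  - by rewrite et opprK.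
  have e3 := (hk (t0 - T / 2)).1.
  have e4 : t0 - T / 2 + T = t0 + T / 2 by field.
  have e5 : - (t0 + T / 2 + - (t0 + t0)) = t0 - T / 2 by ring.
  by rewrite e4 -/c cE in e3; rewrite e5 in eh; lra.
have vi (i : int) : v (t0 + i%:~R * (T / 2)) = - (pi / 2) + i%:~R * pi.
  have [n [->|->]] := int_parity i.
    have -> : t0 + (2 * n)%:~R * (T / 2) = t0 + n%:~R * T by rewrite intrM; field.
    by rewrite vj e0 cE intrM; ring.
  have -> : t0 + (2 * n + 1)%:~R * (T / 2) = (t0 + T / 2) + n%:~R * T.
    by rewrite intrD intrM; field.
  by rewrite vj half cE intrD intrM; ring.
split=> [t|i]; last by rewrite vi sin_multiple.
split=> [/cos_eq0_multiple[j ej]|[i ->]].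
  by exists j; apply: inj; rewrite vi.
by rewrite vi; apply/cos_eq0_multiple; exists i.
Qed.

Section Oscillation.
Variable nu0 : R.
Hypothesis barrier : g < Hnu d m1 m2 h nu0 0.

(** By continuity [v] attains [x], while at every angle with the sine of [nu0] the potential exceeds
    the energy [g]. *)
Lemma nu_avoids t1 t2 x : v t1 <= x <= v t2 -> sin x != sin nu0.
Proof.
move=> hx; have [t <-] := ivt cv hx; apply/eqP => es.
have := barrier; rewrite -(lev' t) !HnuE es; have := sqr_ge0 (pv t); lra.
Qed.

(** A nonzero [k] would make [v] sweep a full turn and meet a translate of the barrier [nu0]. *)
Lemma nu_real_periodic t : v (t + T) = v t /\ pv (t + T) = pv t.
Proof.
have [k hk] : exists k : int, forall t, v (t + T) = v t + k%:~R * (2 * pi) /\ pv (t + T) = pv t.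
  by apply: nu_sol_periodic => //; have [] := per 0.
have pi20 : 0 < 2 * pi :> R by rewrite mulr_gt0// pi_gt0.
have narrow t1 t2 : v t1 + 2 * pi <= v t2 -> False.
  move=> hw; have [j [r [er /andP[r1 r2]]]] := floor_reduction nu0 (v t1) pi20.
  have /negP : sin r != sin nu0 by apply: (@nu_avoids t1 t2); rewrite r1 ltW// (lt_le_trans r2).
  by apply; rewrite er sin_add_2pi_int.
suff k0 : k = 0 by have [] := hk t; rewrite k0 mul0r addr0.
case: (ltgtP k 0) => // kk; exfalso.
  apply: (@narrow (0 + T) 0); rewrite (hk 0).1.
  have : (k + 1)%:~R * (2 * pi) <= 0 :> R by rewrite pmulr_lle0// lerz0; lia.
  by rewrite intrD mulrDl mul1r; lra.
apply: (@narrow 0 (0 + T)); rewrite (hk 0).1 lerD2l -[X in X <= _]mul1r ler_pM2r//.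
by rewrite -[1]/(1%:~R) ler_int; lia.
Qed.

(* Otherwise sin is monotone on the range of v, so sin v takes at its extrema
   two distinct values s1, s2 with e s - b s^2 - g = - b (s - s1) (s - s2),
   which is positive in between. *)
Lemma nu_crosses : exists t, cos (v t) = 0.
Proof.
apply: contrapT => no.
have nz t : cos (v t) != 0 by apply/eqP => e0; apply: no; exists t.
have [tm [tM [bd [em eM]]]] :=
  periodic_extrema T0 (fun t => (sol t).1) (fun t => (nu_real_periodic t).1).
have lt : v tm < v tM.
  have /andP[_ hle] := bd tm; rewrite lt_neqAle hle andbT; apply/eqP => ee.
  have cst t : v t = v tm.
    by apply/eqP; rewrite eq_le {1}ee; have /andP[-> ->] := bd t.
  have dl t : is_derive t 1 v 0.
    by rewrite (_ : v = fun=> v tm); [exact: der_cst|apply/funext].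
  have p0 t : pv t = 0 by apply: (is_derive_unique (sol t).1 (dl t)).
  have dp : is_derive tm 1 pv 0.
    by rewrite (_ : pv = fun=> 0); [exact: der_cst|apply/funext].
  have /eqP := is_derive_unique (sol tm).2 dp; rewrite oppr_eq0 => /eqP ed.
  by case: (reg (lev' tm)) => /eqP.
(* The midpoint serves as an intermediate angle: its sine lies strictly between the two extreme
   sines, where the potential exceeds [g]. *)
pose w := (v tm + v tM) / 2.
have [w1 w2] : v tm < w /\ w < v tM by rewrite /w; split; lra.
have [tw ew] : exists t, v t = w by apply: (@ivt _ v tm tM) => //; rewrite !ltW.
have hs := @is_derive_sin R.
have [x1 /andP[y1 y2] q1] := mvt hs w1; have [x2 /andP[y3 y4] q2] := mvt hs w2.
have [s1 f1] : exists t, v t = x1 by apply: (@ivt _ v tm tM) => //; apply/andP; split; lra.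
have [s2 f2] : exists t, v t = x2 by apply: (@ivt _ v tm tM) => //; apply/andP; split; lra.
have cc : continuous (cos \o v).
  by move=> t; apply: continuous_comp; [exact: cv|exact: continuous_cos].
have same : 0 < cos x1 * cos x2.
  rewrite -f1 -f2; case: (continuous_sign cc nz) => sg; first by rewrite mulr_gt0//; exact: sg.
  by rewrite nmulr_rgt0; exact: sg.
have prod : 0 < (sin w - sin (v tm)) * (sin (v tM) - sin w).
  rewrite q1 q2 mulrACA mulr_gt0// mulr_gt0 ?subr_gt0//.
have := lev' tm; have := lev' tM; have := lev' tw; rewrite !HnuE em eM ew.
move: prod; move: (sin w) (sin (v tm)) (sin (v tM)) => z x y hz.
rewrite expr0n/= mul0r !add0r => h1 h2 h3.
have xy : x != y by apply/eqP => xy; move: hz; rewrite xy; have := sqr_ge0 (z - y); lra.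
have h4 : e = b * (x + y).
  apply/eqP; rewrite -subr_eq0; have : (e - b * (x + y)) * (x - y) = 0 by lra.
  by move/eqP; rewrite mulf_eq0 [x - y == 0]subr_eq0 (negbTE xy) orbF.
have := mulr_gt0 b0 hz; have := sqr_ge0 (pv tw); rewrite h4 in h1 h2 h3; lra.
Qed.

(** Two different angles with zero cosine are at least pi apart, and in between the sine takes every
    value, including that of the barrier. So only one such angle is ever reached, and about it the
    force is odd. *)
Lemma nu_oscillation_times :
  exists t0, (forall t, cos (v t) = 0 <-> exists i : int, t = t0 + i%:~R * (T / 2)) /\
    forall t, cos (v t) = 0 -> sin (v t) = sin (v t0).
Proof.
have [t0 c0] := nu_crosses; exists t0.
have order t1 t2 : cos (v t1) = 0 -> cos (v t2) = 0 -> v t1 < v t2 -> False.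
  move=> c1 c2 lt; have pi0 := pi_gt0 R.
  have gap : v t1 + pi <= v t2.
    move/cos_eq0_multiple: c2 lt => [j2 ->]; move/cos_eq0_multiple: (c1) => [j1 ->].
    rewrite ltrD2l ltr_pM2r// ltr_int => jj; rewrite -addrA lerD2l.
    have : (j1 + 1)%:~R * pi <= j2%:~R * pi :> R by rewrite ler_pM2r// ler_int; lia.
    by rewrite intrD mulrDl mul1r.
  have [|||x /andP[x1 x2] ex] := ivt_le (f := sin) (a := v t1) (b := v t1 + pi) (c := sin nu0).
  - exact: continuous_sin.
  - by rewrite lerDl ltW.
  - rewrite sinDpi; have := sin_le1 nu0; have := sin_geN1 nu0 => n1 n2.
    by case: (sin_of_cos0 c1) => ->; [right|left]; apply/andP; split; lra.
  have := @nu_avoids t1 t2 x; rewrite ex eqxx => H; have : false by apply: H; rewrite x1; lra.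
  by [].
have zeroE t : cos (v t) = 0 <-> v t - v t0 = 0.
  split=> [ct|/eqP]; last by rewrite subr_eq0 => /eqP ->.
  case: (ltgtP (v t) (v t0)) => [lt|lt|->]; last exact: subrr.
    by case: (order t t0).
  by case: (order t0 t).
split=> [t|t /zeroE/eqP]; last by rewrite subr_eq0 => /eqP ->.
rewrite zeroE.
have [L [B [hL _]]] := nu_force_bounded_lip.
apply: (@zeros_half_period R (fun x => - dHnu d m1 m2 h (v t0 + x))
  (fun t => v t - v t0) pv L T t0).
- move=> x y; apply: le_trans (hL _ _) _.
  by have -> : v t0 + x - (v t0 + y) = x - y by ring.
- move=> x; have -> : v t0 - x = v t0 + v t0 - (v t0 + x) by ring.
  by rewrite !dHnuE reflect_sin// reflect_cos// mulrN.
- move=> s; have [h1 h2] := sol s; split.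
    by have := derB h1 (der_cst (v t0) s); rewrite subr0.
  by rewrite addrC subrK.
- exact: T0.
- by move=> s; have [-> ->] := nu_real_periodic s.
- move=> T' hT' H; apply: (minT hT') => s; have [q1 ->] := H s; split=> //.
  by exists 0; rewrite mul0r addr0; lra.
- exact: subrr.
- have := reg (lev' t0); rewrite dHnuE c0 mulr0 eqxx.
  by case.
- move=> s es; have := lev' s; have := lev' t0; rewrite !HnuE.
  by have -> : v s = v t0 by [lra]; lra.
Qed.

End Oscillation.

End Orbit.

Lemma nu_winding_times (v pv : R -> R) (T : R) :
  nu_sol d m1 m2 h v pv -> Hnu d m1 m2 h (v 0) (pv 0) = g -> 0 < T ->
  (forall t, eqmod2pi (v (t + T)) (v t) /\ pv (t + T) = pv t) ->
  (forall T', 0 < T' < T -> ~ (forall t, eqmod2pi (v (t + T')) (v t) /\ pv (t + T') = pv t)) ->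
  (forall x, Hnu d m1 m2 h x 0 < g) ->
  exists t0, (forall t, cos (v t) = 0 <-> exists i : int, t = t0 + i%:~R * (T / 2)) /\
    forall i : int, sin (v (t0 + i%:~R * (T / 2))) = if (2 %| i)%Z then -1 else 1.
Proof.
move=> sol lev T0 per minT below.
have pn0 t : pv t != 0.
  apply/eqP => p0; have := below (v t); rewrite -lev (nu_energy 0 t sol) p0.
  by rewrite ltxx.
have cp : continuous pv := der_continuous (fun t => (sol t).2).
case: (continuous_sign cp pn0) => sg.
  exact: (nu_winding_times_pos sol lev T0 per minT sg).
(* A decreasing motion is reflected about pi/2, which makes it increasing and preserves its sine. *)
have hc := cos_pihalf R.
have mod2 x y : eqmod2pi x y <-> eqmod2pi (pi / 2 + pi / 2 - x) (pi / 2 + pi / 2 - y).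
  by split=> -[k ek]; exists (- k); rewrite ?mulrNz; lra.
have lev2 : Hnu d m1 m2 h (pi / 2 + pi / 2 - v 0) (- pv 0) = g.
  by rewrite HnuE reflect_sin// sqrrN -HnuE.
have [|||t0 [H1 H2]] := nu_winding_times_pos (nu_sol_reflect hc sol) lev2 T0.
- by move=> t; have [q1 ->] := per t; split=> //; exact: (mod2 _ _).1.
- move=> T' hT' H; apply: (minT _ hT') => t; have [q1 /oppr_inj q2] := H t.
  by split=> //; exact: (mod2 _ _).2.
- by move=> t; rewrite oppr_gt0.
exists t0; split=> [t|i]; last by rewrite -H2 reflect_sin.
by rewrite -H1 reflect_cos//; split=> [->|/eqP]; [rewrite oppr0|rewrite oppr_eq0 => /eqP].
Qed.

End Nu.

(** * Interleaving two arithmetic progressions *)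

Section Interleaving.
Variable R : realType.
Variables (t0 u0 al be W y0 : R) (sep : int -> nat).
Hypotheses (W0 : 0 < W) (be0 : 0 < be) (alE : al = W * be) (t0E : t0 = u0 + y0 * be).
Hypothesis av : avoids_lattice W y0.

Let Y (i : int) : R := y0 + i%:~R * W.

(* Position, in the merged order, of the i-th separator: i separators and
   floor(Y i) zeros of lambda precede it. *)
Let pos (i : int) : int := i + Num.floor (Y i).

Lemma Y_neq_int i (m : int) : m%:~R != Y i.
Proof. by have := av i m; rewrite addrC mulrC. Qed.

Lemma Y_succ i : Y (i + 1) = Y i + W.
Proof. by rewrite /Y intrD; ring. Qed.

Lemma pos_lt_int i (k : int) : Y i < k%:~R -> pos i < i + k.
Proof.
move=> h; rewrite /pos ltrD2l -(ltr_int R).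
by have /andP[h1 _] := floor_itv (Y i); exact: le_lt_trans h1 h.
Qed.

Lemma pos_ge_int i (k : int) : k%:~R <= Y i -> i + k <= pos i.
Proof. by move=> h; rewrite /pos lerD2l floor_ge_int. Qed.

Lemma lt_int_of_pos i (k : int) : pos i < i + k -> Y i < k%:~R.
Proof. by rewrite /pos ltrD2l; apply: contraTT; rewrite -!leNgt floor_ge_int. Qed.

Lemma pos_homo i i' : i <= i' -> pos i <= pos i'.
Proof.
move=> h; rewrite /pos lerD// le_floor// /Y lerD2l ler_wpM2r ?(ltW W0)//.
by rewrite ler_int.
Qed.

Lemma pos_succ i : pos i < pos (i + 1).
Proof.
rewrite /pos; have : Num.floor (Y i) <= Num.floor (Y (i + 1)).
  by apply: le_floor; rewrite Y_succ lerDl ltW.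
lia.
Qed.

Lemma pos_block_exists k : exists i, pos i <= k < pos (i + 1).
Proof.
(* The sum [i + Y i] is y0 + i (W + 1), and it reaches [k + 1] at i = z; the block of [k] is the
   last integer strictly below [z]. *)
pose z := (k%:~R + 1 - y0) / (W + 1).
have W1 : 0 < W + 1 by rewrite addr_gt0.
exists (Num.ceil z - 1).
have /andP[c1 c2] := ceil_itv z.
set i := Num.ceil z in c1 c2 *.
rewrite intrB in c1.
rewrite ltr_pdivlMr// in c1; rewrite ler_pdivrMr// in c2.
apply/andP; split.
  have -> : (pos (i - 1) <= k) = (pos (i - 1) < (i - 1) + (k + 1 - (i - 1))) by lia.
  by apply: pos_lt_int; rewrite /Y !intrD !intrN !intrD intrN; lra.
have : (i - 1 + 1) + (k - i + 1) <= pos (i - 1 + 1).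
  by apply: pos_ge_int; rewrite /Y subrK !intrD intrN; lra.
lia.
Qed.

Let blk k := projT1 (cid (pos_block_exists k)).

Lemma blkP k : pos (blk k) <= k < pos (blk k + 1).
Proof. by rewrite /blk; case: cid. Qed.

Lemma blk_unique i k : pos i <= k < pos (i + 1) -> blk k = i.
Proof.
move=> /andP[h1 h2]; have /andP[h3 h4] := blkP k.
case: (ltgtP (blk k) i) => // h.
  have : pos (blk k + 1) <= pos i by apply: pos_homo; lia.
  lia.
have : pos (i + 1) <= pos (blk k) by apply: pos_homo; lia.
lia.
Qed.

Lemma blk_pos i : blk (pos i) = i.
Proof. by apply: blk_unique; rewrite lexx pos_succ. Qed.

(** The zero number [m] between separators [i] and [i + 1] has position [i + m], whence the index
    [k - blk k]. *)
Let time k : R := if k == pos (blk k) then t0 + (blk k)%:~R * al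
                  else u0 + (k - blk k)%:~R * be.

Let symb k : nat := if k == pos (blk k) then sep (blk k) else 3%N.

Lemma time_pos i : time (pos i) = t0 + i%:~R * al.
Proof. by rewrite /time blk_pos eqxx. Qed.

Lemma time_between i k : pos i < k < pos (i + 1) -> time k = u0 + (k - i)%:~R * be.
Proof.
move=> /andP[h1 h2]; have e : blk k = i by apply: blk_unique; rewrite ltW.
by rewrite /time e gt_eqF.
Qed.

Lemma symb_between i k : pos i < k < pos (i + 1) -> symb k = 3%N.
Proof.
move=> /andP[h1 h2]; have e : blk k = i by apply: blk_unique; rewrite ltW.
by rewrite /symb e gt_eqF.
Qed.

Lemma sep_timeE i : t0 + i%:~R * al = u0 + Y i * be.
Proof. by rewrite t0E alE /Y; ring. Qed.

Lemma time_succ k : time k < time (k + 1).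
Proof.
have /andP[h1 h2] := blkP k; set i := blk k in h1 h2 *.
have tk : (k = pos i /\ time k = u0 + Y i * be) \/
    (pos i < k /\ time k = u0 + (k - i)%:~R * be).
  move: h1; rewrite le_eqVlt => /orP[/eqP e|h1]; [left|right].
    by rewrite -e time_pos sep_timeE.
  by split=> //; apply: time_between; rewrite h1.
have [h3|h3] := ltP (k + 1) (pos (i + 1)).
  have -> : time (k + 1) = u0 + (k + 1 - i)%:~R * be.
    by apply: time_between; rewrite h3 andbT; lia.
  case: tk => [[e ->]|[_ ->]]; rewrite ltrD2l ltr_pM2r//.
    by apply: lt_int_of_pos; rewrite -e; lia.
  by rewrite ltr_int; lia.
have e : k + 1 = pos (i + 1) by lia.
rewrite e time_pos sep_timeE.
case: tk => [[_ ->]|[_ ->]]; rewrite ltrD2l ltr_pM2r//.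
  by rewrite Y_succ ltrDl.
(* Avoiding the lattice excludes a tie between the last zero of a block and the next separator. *)
rewrite lt_neqAle Y_neq_int leNgt /=; apply/negP => /pos_lt_int; lia.
Qed.

Lemma time_of_zero (m : int) : exists i k, pos i < k < pos (i + 1) /\ time k = u0 + m%:~R * be.
Proof.
have [i hi] : exists i, Y i < m%:~R <= Y (i + 1).
  exists (Num.ceil ((m%:~R - y0) / W) - 1).
  have /andP[] := ceil_itv ((m%:~R - y0) / W).
  rewrite ltr_pdivlMr// ler_pdivrMr// /Y subrK => c1 c2.
  by apply/andP; split; lra.
case/andP: hi => h1 h2; have hk : pos i < i + m < pos (i + 1).
  by rewrite pos_lt_int//=; have := pos_ge_int h2; lia.
exists i, (i + m); split => //.
by rewrite (time_between hk) (_ : i + m - i = m)//; lia.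
Qed.

(** The length is floor(Y i + W) - floor(Y i), and the test in [sturm] asks whether the fractional
    parts of [Y i] and [W] produce a carry. *)
Lemma block_length i : pos (i + 1) - pos i - 1 = sturm W y0 (i + 1).
Proof.
rewrite /sturm addrK -/(Y i) /pos /fracR.
have /andP[f1 f2] := floor_itv (Y i); have /andP[g1 g2] := floor_itv W.
rewrite !intrD in f2 g2; rewrite Y_succ.
case: ltP => h.
  suff -> : Num.floor (Y i + W) = Num.floor (Y i) + Num.floor W by lia.
  by apply: floor_def; rewrite !intrD; apply/andP; split; lra.
suff -> : Num.floor (Y i + W) = Num.floor (Y i) + Num.floor W + 1 by lia.
by apply: floor_def; rewrite !intrD; apply/andP; split; lra.
Qed.

Variables l v : R -> R.
Hypothesis zeros : forall t, l t = 0 <-> exists m : int, t = u0 + m%:~R * be.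
Hypothesis seps : forall t, (eqmod2pi (v t) (pi / 2) \/ eqmod2pi (v t) (- (pi / 2))) <->
  exists i : int, t = t0 + i%:~R * al.
Hypothesis symbols : forall i, (sep i = 1%N /\ eqmod2pi (v (t0 + i%:~R * al)) (- (pi / 2))) \/
  (sep i = 2%N /\ eqmod2pi (v (t0 + i%:~R * al)) (pi / 2)).

Lemma interleaved_noncollision : noncollision l v.
Proof.
move=> t [/zeros[m e1] /seps[i e2]].
have := Y_neq_int i m; rewrite e1 sep_timeE in e2.
by move/addrI: e2 => /(mulIf (lt0r_neq0 be0)) ->; rewrite eqxx.
Qed.

Lemma interleaved_syzygies : exists s, syzygy_seq l v s /\ block_form s sep (sturm W y0).
Proof.
have nc := interleaved_noncollision.
exists symb; split; last first.
  exists pos; split; first exact: pos_succ.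
  split; first by move=> i; rewrite /symb blk_pos eqxx.
  by split; [exact: symb_between|exact: block_length].
have hsep i : syz l v (t0 + i%:~R * al) (sep i).
  have nl : l (t0 + i%:~R * al) != 0.
    by apply/eqP => e; apply: (nc (t0 + i%:~R * al)); split=> //; apply/seps; exists i.
  by case: (symbols i) => -[-> h]; right; [left|right].
have hzero (m : int) : syz l v (u0 + m%:~R * be) 3.
  have e : l (u0 + m%:~R * be) = 0 by apply/zeros; exists m.
  left; split=> //; split=> //.
  by split=> h; apply: (nc _ (conj e _)); [left|right].
exists time; split; first exact: time_succ.
have hk k : syz l v (time k) (symb k).
  have /andP[h1 h2] := blkP k; move: h1; rewrite le_eqVlt => /orP[/eqP e|h1].
    by rewrite -e time_pos /symb blk_pos eqxx; exact: hsep.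
  have hb : pos (blk k) < k < pos (blk k + 1) by rewrite h1.
  by rewrite (time_between hb) (symb_between hb); exact: hzero.
split=> // t; split=> [[a]|[k <-]]; last by exists (symb k).
have hz : l t = 0 -> exists k, time k = t.
  by move=> /zeros[m ->]; have [_ [k [_ e]]] := time_of_zero m; exists k.
have hs : eqmod2pi (v t) (pi / 2) \/ eqmod2pi (v t) (- (pi / 2)) -> exists k, time k = t.
  by move=> /seps[i ->]; exists (pos i); rewrite time_pos.
by case=> [[_ [/hz]]|[[_ [h _]]|[_ [h _]]]] //; apply: hs; [right|left].
Qed.

End Interleaving.

(** * Syzygy sequences *)

Section Components.
Variable R : realType.

Lemma path_in_component (A : set (R * R)) z (x p : R -> R) t0 t :
  continuous x -> continuous p -> (forall t, A (x t, p t)) ->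
  connected_component A z (x t0, p t0) -> connected_component A z (x t, p t).
Proof.
move=> cx cp hA hz; apply: (connected_component_trans hz).
have cR : connected [set: R] by apply/connected_intervalP => a b _ _ c _.
have cxp : continuous (fun t => (x t, p t)).
  by move=> s; apply: (@cvg_pair _ _ _ _ (nbhs (x s)) (nbhs (p s))); [exact: cx|exact: cp].
apply: (connected_component_max (B := (fun t => (x t, p t)) @` setT)).
- by exists t0.
- by move=> _ [s _ <-].
- exact: (connected_continuous_connected cR (continuous_subspaceT cxp)).
- by exists t.
Qed.

Variables (d m1 m2 h g : R) (zn : R * R).
Hypotheses (reg : regular_nu d m1 m2 h g) (levn : lev_nu d m1 m2 h g zn).
Let K := connected_component (lev_nu d m1 m2 h g) zn.

Lemma Hnu_add_2pi_int x p (k : int) :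
  Hnu d m1 m2 h (x + k%:~R * (2 * pi)) p = Hnu d m1 m2 h x p.
Proof. by rewrite !HnuE sin_add_2pi_int. Qed.

(** The connected set [K] projects onto an interval containing a full turn, so every angle occurs on
    the level up to 2 pi; regularity makes the resulting weak inequality strict. *)
Lemma winds_below_level : winds K -> forall x, Hnu d m1 m2 h x 0 < g.
Proof.
move=> [x0 [p0 [k1 k2]]]; apply: (nu_regular_max reg) => x.
have pi20 : 0 < 2 * pi :> R by rewrite mulr_gt0// pi_gt0.
have cK : connected K by exact: component_connected.
have /connected_intervalP itv : connected ((fun z : R * R => z.1) @` K).
  apply: connected_continuous_connected => //; apply: continuous_subspaceT.
  by move=> z; exact: cvg_fst.
have [j [r [-> /andP[r1 r2]]]] := floor_reduction x x0 pi20.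
have [[y p] hK /= <-] : ((fun z : R * R => z.1) @` K) r.
  by apply: (itv x0 (x0 + 2 * pi)); [exists (x0, p0)|exists (x0 + 2 * pi, p0)|rewrite r1 ltW].
have := connected_component_sub hK; rewrite /lev_nu /= => <-.
by rewrite Hnu_add_2pi_int !HnuE; have := sqr_ge0 p; lra.
Qed.

(** Below the level, each sign of the momentum gives a graph over the whole angle axis; the one
    through [zn] joins that point to its translate. *)
Lemma winds_of_below_level : (forall x, Hnu d m1 m2 h x 0 < g) -> winds K.
Proof.
move=> below; have := levn; rewrite /lev_nu /=.
pose x0 := zn.1; pose p0 := zn.2; rewrite -/x0 -/p0 => lev0.
pose q x : R := Num.sg p0 * Num.sqrt (2 * (g - Hnu d m1 m2 h x 0)).
have pos x : 0 < 2 * (g - Hnu d m1 m2 h x 0) by rewrite mulr_gt0// subr_gt0.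
have p00 : p0 != 0.
  by apply/eqP => e0; have := below x0; rewrite -lev0 e0 ltxx.
have on x : lev_nu d m1 m2 h g (x, q x).
  rewrite /lev_nu/= HnuE /q exprMn sqr_sqrtr ?(ltW (pos x))//.
  by rewrite sqr_sg p00 mul1r HnuE expr0n/= mul0r add0r; field.
have q0 : q x0 = p0.
  rewrite /q -lev0 !HnuE expr0n/= mul0r add0r addrK.
  have -> : 2 * (p0 ^+ 2 / 2) = p0 ^+ 2 by field.
  by rewrite sqrtr_sqr -numEsg.
have cq : continuous q.
  move=> x; apply: cvgM; first exact: cvg_cst.
  apply: (@continuous_comp _ _ _ (fun x => 2 * (g - Hnu d m1 m2 h x 0)) Num.sqrt);
    last exact: sqrt_continuous.
  have hd (y : R) : is_derive y 1 (fun x => 2 * (g - (0 ^+ 2 / 2 + (d * (m1 - m2) * sin x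
      - (- (h * d ^+ 2)) * sin x ^+ 2)))) (2 * (0 - (0 + dHnu d m1 m2 h y))).
    exact: (derZ 2 (derB (der_cst g y) (derD (der_cst _ y) (is_derive_Vnu d m1 m2 h y)))).
  have -> : (fun x => 2 * (g - Hnu d m1 m2 h x 0)) = (fun x => 2 * (g - (0 ^+ 2 / 2 +
      (d * (m1 - m2) * sin x - (- (h * d ^+ 2)) * sin x ^+ 2)))).
    by apply/funext => y; rewrite HnuE.
  exact: (der_continuous hd).
have ci : continuous (fun x : R => x) by move=> x; exact: cvg_id.
have K0 : K (x0, q x0) by rewrite q0 -surjective_pairing; exact: connected_component_refl.
exists x0, p0; split; first by rewrite q0 in K0.
have -> : p0 = q (x0 + 2 * pi).
  rewrite -[LHS]q0 /q; have -> : x0 + 2 * pi = x0 + 1%:~R * (2 * pi) by rewrite mul1r.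
  by rewrite Hnu_add_2pi_int.
exact: (path_in_component (t0 := x0) _ ci cq on K0).
Qed.

Lemma barrier_of_not_winds : ~ winds K -> exists x, g < Hnu d m1 m2 h x 0.
Proof.
move=> nw; apply: contrapT => no; apply: nw; apply: winds_of_below_level.
by apply: (nu_regular_max reg) => x; rewrite leNgt; apply/negP => hx; apply: no; exists x.
Qed.

End Components.

(** * Orbits on a fixed torus *)

Section TwoCenters.
Variable R : realType.
Variables (d m1 m2 h g : R) (zl zn : R * R) (Tl Tn : R).
Hypotheses (d0 : 0 < d) (m10 : 0 < m1) (m20 : 0 < m2) (h0 : h < 0).
Hypotheses (regl : regular_lam d m1 m2 h (- g)) (regn : regular_nu d m1 m2 h g).
Hypotheses (levl : lev_lam d m1 m2 h (- g) zl) (levn : lev_nu d m1 m2 h g zn).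
Let Cl := connected_component (lev_lam d m1 m2 h (- g)) zl.
Let K := connected_component (lev_nu d m1 m2 h g) zn.
Hypotheses (perl : lam_period d m1 m2 h Cl Tl) (pern : nu_period d m1 m2 h K Tn).
Let W := Tn / Tl.

Lemma lam_orbit_in_component (l pl : R -> R) t0 t : lam_sol d m1 m2 h l pl ->
  Cl (l t0, pl t0) -> Cl (l t, pl t).
Proof.
move=> sol hC; have [cl cp] := ode_sol_continuous (F := fun x => - dHlam d m1 m2 h x) sol.
apply: (path_in_component (t0 := t0)) => // s.
rewrite /lev_lam /= (lam_energy s t0 sol).
exact: (connected_component_sub hC).
Qed.

Lemma nu_torus_period (v pv : R -> R) (k : int) : nu_sol d m1 m2 h v pv ->
  K (v 0 + k%:~R * (2 * pi), pv 0) ->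
  [/\ Hnu d m1 m2 h (v 0) (pv 0) = g, 0 < Tn,
    (forall t, eqmod2pi (v (t + Tn)) (v t) /\ pv (t + Tn) = pv t) &
    (forall T', 0 < T' < Tn ->
       ~ (forall t, eqmod2pi (v (t + T')) (v t) /\ pv (t + T') = pv t))].
Proof.
move=> sol hK; have := connected_component_sub hK; rewrite /lev_nu /= Hnu_add_2pi_int => lev.
have [T0 [per minT]] := pern (nu_sol_translate k sol) hK.
have mod2 (x y : R) : eqmod2pi (x + k%:~R * (2 * pi)) (y + k%:~R * (2 * pi)) <-> eqmod2pi x y.
  by split=> -[j ej]; exists j; lra.
split=> // [t|T' hT' H].
  by have [q1 q2] := per t; split=> //; exact: ((mod2 _ _).1 q1).
by apply: (minT _ hT') => t; have [q1 q2] := H t; split=> //; exact: ((mod2 _ _).2 q1).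
Qed.

Lemma typeL_top : typeL Cl K -> Hlam d m1 m2 h 0 0 <= - g.
Proof.
move=> [_ [p /connected_component_sub]]; rewrite /lev_lam /= => <-.
by rewrite !HlamE; have := sqr_ge0 p; lra.
Qed.

(* A torus with -g < V_lambda(0) needs a double well a > 2 b, and then
   V_nu <= a - b < g everywhere, so C_nu winds. *)
Lemma typeS_top : typeS Cl K -> Hlam d m1 m2 h 0 0 <= - g.
Proof.
move=> nw; have [x bx] := barrier_of_not_winds regn levn nw.
rewrite leNgt; apply/negP => top.
have := levl; rewrite /lev_lam /= HlamE; rewrite HlamE coshR0 in top; rewrite HnuE in bx.
move: top bx; set a := d * (m1 + m2); set b := - (h * d ^+ 2); set e := d * (m1 - m2).
have b0 : 0 < b by rewrite oppr_gt0 nmulr_rlt0// exprn_gt0.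
have [ea1 ea2] : e < a /\ - a < e.
  by have := mulr_gt0 d0 m10; have := mulr_gt0 d0 m20; rewrite /e /a; split; lra.
have c1 := coshR_ge1 zl.1; have s1 := sin_le1 x; have s2 := sin_geN1 x.
have := sqr_ge0 zl.2; move: (zl.2 ^+ 2) => q q0.
move: a b e b0 ea1 ea2 => a b e b0 ea1 ea2.
move: (coshR zl.1) (sin x) c1 s1 s2 => c s c1 s1 s2.
rewrite expr0n/= mul0r !add0r expr1n => top bx lev.
have a2b : 2 * b < a.
  (* For a <= 2 b the polynomial b c^2 - a c is minimal at c = 1 on c >= 1, so no point could have
     level [- g]. *)
  rewrite ltNge; apply/negP => ab.
  have : 0 <= (c - 1) * (b * (c + 1) - a) by apply: mulr_ge0; nra.
  lra.
(* From |e| < a one gets e s <= a |s|, and (1 - |s|) (a - b (1 + |s|)) >= 0 says a |s| - b s^2 <= a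
   - b. *)
have [s0|s0] := leP 0 s.
  have : 0 <= (1 - s) * (a - b * (1 + s)) by apply: mulr_ge0; nra.
  have : e * s <= a * s by rewrite ler_wpM2r// ltW.
  nra.
have : 0 <= (1 + s) * (a - b * (1 - s)) by apply: mulr_ge0; nra.
have : e * s <= a * (- s) by nra.
nra.
Qed.

Section Rotation.
Variables (l pl v pv : R -> R).
Hypotheses (soll : lam_sol d m1 m2 h l pl) (hCl : Cl (l 0, pl 0)).
Hypotheses (soln : nu_sol d m1 m2 h v pv).
Hypothesis hK : exists k : int, K (v 0 + k%:~R * (2 * pi), pv 0).

Lemma orbit_Tl_gt0 : 0 < Tl.
Proof. by have [] := perl soll hCl. Qed.

Lemma orbit_Tn_gt0 : 0 < Tn.
Proof. by have [k hk] := hK; have [] := nu_torus_period soln hk. Qed.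

Lemma orbit_zeros : Hlam d m1 m2 h 0 0 <= - g ->
  exists u0, forall t, l t = 0 <-> exists j : int, t = u0 + j%:~R * (Tl / 2).
Proof.
move=> top; have [T0 [per minT]] := perl soll hCl.
exact: (lam_zero_times d0 m10 m20 h0 regl soll (connected_component_sub hCl) T0 per top minT).
Qed.

Lemma orbit_winding_separators : winds K ->
  exists t0, (forall t, (eqmod2pi (v t) (pi / 2) \/ eqmod2pi (v t) (- (pi / 2))) <->
      exists i : int, t = t0 + i%:~R * (Tn / 2)) /\
    forall i, (sepL i = 1%N /\ eqmod2pi (v (t0 + i%:~R * (Tn / 2))) (- (pi / 2))) \/
      (sepL i = 2%N /\ eqmod2pi (v (t0 + i%:~R * (Tn / 2))) (pi / 2)).
Proof.
move=> w; have [k hk] := hK; have [lev T0 per minT] := nu_torus_period soln hk.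
have [t0 [H1 H2]] := nu_winding_times soln lev T0 per minT (winds_below_level regn w).
exists t0; split=> [t|i]; first by rewrite eqmod2pi_cos0.
have := H2 i; rewrite /sepL; case: ifP => _ hs.
  by left; split=> //; apply/eqmod2pi_Npihalf.
by right; split=> //; apply/eqmod2pi_pihalf.
Qed.

Lemma orbit_oscillation_separators : ~ winds K ->
  exists t0 (c : nat), [/\ (c = 1 \/ c = 2)%N,
    (forall t, (eqmod2pi (v t) (pi / 2) \/ eqmod2pi (v t) (- (pi / 2))) <->
      exists i : int, t = t0 + i%:~R * (Tn / 2)) &
    forall i : int, (c = 1%N /\ eqmod2pi (v (t0 + i%:~R * (Tn / 2))) (- (pi / 2))) \/
      (c = 2%N /\ eqmod2pi (v (t0 + i%:~R * (Tn / 2))) (pi / 2))].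
Proof.
move=> nw; have [k hk] := hK; have [lev T0 per minT] := nu_torus_period soln hk.
have [x bx] := barrier_of_not_winds regn levn nw.
have [t0 [H1 H2]] := nu_oscillation_times d0 h0 regn soln lev T0 per minT bx.
exists t0.
have ct0 : cos (v t0) = 0 by apply/H1; exists 0; rewrite mul0r addr0.
have hs i : sin (v (t0 + i%:~R * (Tn / 2))) = sin (v t0) by apply: H2; apply/H1; exists i.
case: (sin_of_cos0 ct0) => es; [exists 2%N|exists 1%N]; (split; first by [left|right]).
- by move=> t; rewrite eqmod2pi_cos0.
- by move=> i; right; split=> //; apply/eqmod2pi_pihalf; rewrite hs.
- by move=> t; rewrite eqmod2pi_cos0.
- by move=> i; left; split=> //; apply/eqmod2pi_Npihalf; rewrite hs.
Qed.

(* In units of Tl/2, measured from a zero of lambda, the separators sit at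
   y0 + i W. *)
Lemma orbit_block_form (sep : int -> nat) t0 u0 : noncollision l v ->
  (forall t, l t = 0 <-> exists j : int, t = u0 + j%:~R * (Tl / 2)) ->
  (forall t, (eqmod2pi (v t) (pi / 2) \/ eqmod2pi (v t) (- (pi / 2))) <->
      exists i : int, t = t0 + i%:~R * (Tn / 2)) ->
  (forall i, (sep i = 1%N /\ eqmod2pi (v (t0 + i%:~R * (Tn / 2))) (- (pi / 2))) \/
      (sep i = 2%N /\ eqmod2pi (v (t0 + i%:~R * (Tn / 2))) (pi / 2))) ->
  exists s y0, avoids_lattice W y0 /\ syzygy_seq l v s /\ block_form s sep (sturm W y0).
Proof.
move=> nc zeros seps symbols; have Tl0 := orbit_Tl_gt0; have Tn0 := orbit_Tn_gt0.
have W0 : 0 < W by rewrite divr_gt0.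
have be0 : 0 < Tl / 2 by rewrite divr_gt0.
have alE : Tn / 2 = W * (Tl / 2) by rewrite /W; field; rewrite gt_eqF.
pose y0 := (t0 - u0) / (Tl / 2).
have t0E : t0 = u0 + y0 * (Tl / 2) by rewrite /y0; field; rewrite gt_eqF.
(* A lattice point on the line is a separator coinciding with a zero of lambda, that is, a
   collision. *)
have av : avoids_lattice W y0.
  move=> x y; apply/eqP => exy; apply: (nc (t0 + x%:~R * (Tn / 2))); split.
    by apply/zeros; exists y; rewrite exy {1}t0E alE; ring.
  by apply/seps; exists x.
have [s [H1 H2]] := interleaved_syzygies W0 be0 alE t0E av zeros seps symbols.
by exists s, y0.
Qed.

(* Shifting lambda in time moves the intercept to any prescribed value. *)
Lemma realize_block_form (sep : int -> nat) t0 u0 y0 : avoids_lattice W y0 ->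
  (forall t, l t = 0 <-> exists j : int, t = u0 + j%:~R * (Tl / 2)) ->
  (forall t, (eqmod2pi (v t) (pi / 2) \/ eqmod2pi (v t) (- (pi / 2))) <->
      exists i : int, t = t0 + i%:~R * (Tn / 2)) ->
  (forall i, (sep i = 1%N /\ eqmod2pi (v (t0 + i%:~R * (Tn / 2))) (- (pi / 2))) \/
      (sep i = 2%N /\ eqmod2pi (v (t0 + i%:~R * (Tn / 2))) (pi / 2))) ->
  exists l pl v pv : R -> R,
       reg_orbit d m1 m2 h l pl v pv /\ on_torus Cl K l pl v pv /\
       noncollision l v /\
       exists s, syzygy_seq l v s /\ block_form s sep (sturm W y0).
Proof.
move=> av zeros seps symbols; have Tl0 := orbit_Tl_gt0; have Tn0 := orbit_Tn_gt0.
have W0 : 0 < W by rewrite divr_gt0.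
have be0 : 0 < Tl / 2 by rewrite divr_gt0.
have alE : Tn / 2 = W * (Tl / 2) by rewrite /W; field; rewrite gt_eqF.
pose sg := u0 - t0 + y0 * (Tl / 2).
have t0E : t0 = (u0 - sg) + y0 * (Tl / 2) by rewrite /sg; ring.
have zeros' t : l (t + sg) = 0 <-> exists j : int, t = (u0 - sg) + j%:~R * (Tl / 2).
  by rewrite zeros; split=> -[j ej]; exists j; lra.
exists (fun t => l (t + sg)), (fun t => pl (t + sg)), v, pv.
have nc := interleaved_noncollision be0 alE t0E av zeros' seps.
split; [split=> //|split; [split=> //|split=> //]].
- exact: (ode_sol_shift (F := fun x => - dHlam d m1 m2 h x) sg soll).
- exact: (lam_orbit_in_component (0 + sg) soll hCl).
- exact: (interleaved_syzygies W0 be0 alE t0E av zeros' seps symbols).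
Qed.

End Rotation.

(** The converse is given no orbit; this one makes the period hypotheses effective and is then
    shifted. *)
Lemma torus_orbit_exists : exists l pl v pv : R -> R,
  [/\ lam_sol d m1 m2 h l pl, Cl (l 0, pl 0), nu_sol d m1 m2 h v pv &
      exists k : int, K (v 0 + k%:~R * (2 * pi), pv 0)].
Proof.
have [F [L [_ _ _ ex]]] := lam_effective_force g d0 m10 m20 h0.
have [l [pl [sl [e1 e2]]]] := ex _ _ levl.
have [v [pv [sn [e3 e4]]]] := nu_exists d m1 m2 h zn.1 zn.2.
exists l, pl, v, pv; split=> //.
  by rewrite e1 e2 -surjective_pairing; exact: connected_component_refl.
by exists 0; rewrite mul0r addr0 e3 e4 -surjective_pairing; exact: connected_component_refl.
Qed.

End TwoCenters.

Unset Implicit Arguments.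

Theorem theorem2 (R : realType) (d m1 m2 h g : R) (zl zn : R * R) (Tl Tn : R) :
  0 < d -> 0 < m1 -> 0 < m2 -> h < 0 ->
  regular_lam d m1 m2 h (- g) -> regular_nu d m1 m2 h g ->
  lev_lam d m1 m2 h (- g) zl -> lev_nu d m1 m2 h g zn ->
  let Cl := connected_component (lev_lam d m1 m2 h (- g)) zl in
  let K := connected_component (lev_nu d m1 m2 h g) zn in
  lam_period d m1 m2 h Cl Tl -> nu_period d m1 m2 h K Tn ->
  let W := Tn / Tl in
  (* direct part *)
  (forall l pl v pv : R -> R,
     reg_orbit d m1 m2 h l pl v pv -> on_torus Cl K l pl v pv ->
     noncollision l v ->
     (typeP Cl K ->
        exists s, syzygy_seq l v s /\
          (forall k : int, s k = (if (2 %| k)%Z then 1 else 2)%N)) /\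
     (typeL Cl K ->
        exists s y0, avoids_lattice W y0 /\ syzygy_seq l v s /\
          block_form s sepL (sturm W y0)) /\
     (typeS Cl K ->
        exists s y0 (c : nat), (c = 1 \/ c = 2)%N /\ avoids_lattice W y0 /\
          syzygy_seq l v s /\ block_form s (fun _ => c) (sturm W y0))) /\
  (* converse, type L *)
  (typeL Cl K ->
     forall y0, avoids_lattice W y0 ->
     exists l pl v pv : R -> R,
       reg_orbit d m1 m2 h l pl v pv /\ on_torus Cl K l pl v pv /\
       noncollision l v /\
       exists s, syzygy_seq l v s /\ block_form s sepL (sturm W y0)) /\
  (* converse, type S *)
  (typeS Cl K ->
     exists c : nat, (c = 1 \/ c = 2)%N /\
     forall y0, avoids_lattice W y0 ->
     exists l pl v pv : R -> R,
       reg_orbit d m1 m2 h l pl v pv /\ on_torus Cl K l pl v pv /\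
       noncollision l v /\
       exists s, syzygy_seq l v s /\ block_form s (fun _ => c) (sturm W y0)).
Proof.
move=> d0 m10 m20 h0 regl regn levl levn Cl K perl pern W.
have [L [PL [V [PV [sl hl sn hn]]]]] := torus_orbit_exists d0 m10 m20 h0 levl levn.
split; [|split].
- move=> l pl v pv [soll soln] [hCl hK] nc; split; [|split].
  + move=> [w nm].
    have [t0 [seps symbols]] := orbit_winding_separators regn pern soln hK w.
    have Tn0 := orbit_Tn_gt0 pern soln hK.
    (* The orbit stays in [Cl], which misses lambda = 0, so the separators alone form the
       sequence. *)
    have nl t : l t != 0.
      apply/eqP => e; apply: nm; exists (pl t); rewrite -e.
      exact: (lam_orbit_in_component t soll hCl).
    exists sepL; split=> //; exists (fun k => t0 + k%:~R * (Tn / 2)).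
    have hk k : syz l v (t0 + k%:~R * (Tn / 2)) (sepL k).
      by case: (symbols k) => -[-> ?]; right; [left|right].
    split; first by move=> k; rewrite intrD; lra.
    split=> // t; split=> [[a ha]|[k <-]]; last by exists (sepL k).
    have [|i ->] := (seps t).1; last by exists i.
    case: ha => [[_ [e _]]|[[_ [e _]]|[_ [e _]]]]; [|by right|by left].
    by have /eqP := nl t.
  + move=> tL; have [w _] := tL.
    have [t0 [seps symbols]] := orbit_winding_separators regn pern soln hK w.
    have [u0 zeros] := orbit_zeros d0 m10 m20 h0 regl perl soll hCl (typeL_top tL).
    exact: (orbit_block_form perl pern soll hCl soln hK nc zeros seps symbols).
  + move=> tS.
    have [t0 [c [hc seps symbols]]] := orbit_oscillation_separators d0 h0 regn levn pern soln hK tS.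
    have top := typeS_top d0 m10 m20 h0 regn levl levn tS.
    have [u0 zeros] := orbit_zeros d0 m10 m20 h0 regl perl soll hCl top.
    have [s [y0 [av H]]] := orbit_block_form perl pern soll hCl soln hK nc zeros seps symbols.
    by exists s, y0, c.
- move=> tL y0 av; have [w _] := tL.
  have [t0 [seps symbols]] := orbit_winding_separators regn pern sn hn w.
  have [u0 zeros] := orbit_zeros d0 m10 m20 h0 regl perl sl hl (typeL_top tL).
  exact: (realize_block_form perl pern sl hl sn hn av zeros seps symbols).
- move=> tS.
  have [t0 [c [hc seps symbols]]] := orbit_oscillation_separators d0 h0 regn levn pern sn hn tS.
  have top := typeS_top d0 m10 m20 h0 regn levl levn tS.
  have [u0 zeros] := orbit_zeros d0 m10 m20 h0 regl perl sl hl top.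
  (* Shifting lambda leaves nu untouched, so the symbol [c] of one fixed orbit serves every
     intercept. *)
  exists c; split=> // y0 av.
  exact: (realize_block_form perl pern sl hl sn hn av zeros seps symbols).
Qed.
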